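(* Let $n\ge1$ and $1\le k\le 2n$ be integers. For all real $u_1,\dots,u_k$ with $\sin(u_i)\neq0$ for all $i$ and $\sin(u_i-u_j)\ne0$ for all $i<j$, $$Z_n(u_1,\dots,u_k,0^{2n-k})=\zeta_{n,k}\,\frac{\det_{1\le i,j\le k}\Big(f_n^{(j-1)}(u_i)\Big)}{\prod_{i=1}^{k}\sin^{2n-k}(u_i)\prod_{1\le i<j\le k}\sin(u_i-u_j)},\qquad \zeta_{n,k}=\frac{1}{A_n^{k-1}\prod_{j=1}^{k-1}(2n-j)^{k-j}},$$ where $f_n^{(m)}$ denotes the $m$-th derivative of $f_n$. In particular, for $k=2n$, $$Z_n(u_1,\dots,u_{2n})=\frac{1}{A_n^{2n-1}H(2n-1)}\det_{1\le i,j\le 2n}\Big(f_n^{(j-1)}(u_i)\Big)\prod_{1\le i<j\le 2n}\sin(u_i-u_j)^{-1},$$ where $H(m)=\prod_{k=1}^{m}k^k$ is the hyperfactorial.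
   Context: An alternating sign matrix (ASM) of order $n$ is an $n\times n$ matrix $M=(m_{i,j})$ with entries in $\{0,1,-1\}$ such that in every row and every column the entries sum to $1$ and the nonzero entries alternate in sign; $\mathrm{ASM}_n$ is the set of these and $A_n=|\mathrm{ASM}_n|$. Let $a(u)=\frac{2}{\sqrt3}\sin(\frac\pi3+u)$ and $b(u)=\frac{2}{\sqrt3}\sin(\frac\pi3-u)$. For $M\in\mathrm{ASM}_n$ put $R_{i,j}=\sum_{l\le j}m_{i,l}$ and $C_{i,j}=\sum_{l\le i}m_{l,j}$ (both in $\{0,1\}$). Given real spectral parameters $x_1,\dots,x_n,y_1,\dots,y_n$, the weight of vertex $(i,j)$ in $M$ is $w_{i,j}=1$ if $m_{i,j}\ne0$, $w_{i,j}=a(x_i-y_j)$ if $m_{i,j}=0$ and $R_{i,j}=C_{i,j}$, and $w_{i,j}=b(x_i-y_j)$ if $m_{i,j}=0$ and $R_{i,j}\neq C_{i,j}$. The partition function (square ice / six-vertex model with domain wall boundary conditions at crossing parameter $\eta=2\pi/3$) is $Z_n(x_1,\dots,x_n;y_1,\dots,y_n)=\sum_{M\in\mathrm{ASM}_n}\prod_{i,j=1}^n w_{i,j}$. It is known (Stroganov) that $Z_n$ is symmetric under all permutations of the $2n$ variables $x_1,\dots,x_n,y_1,\dots,y_n$, so one writes $Z_n(u_1,\dots,u_{2n})$ for its value when these $2n$ variables are $u_1,\dots,u_{2n}$ in some order, and $Z_n(u_1,\dots,u_k,0^{2n-k})$ when $k$ of them are $u_1,\dots,u_k$ and the remaining $2n-k$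 are $0$. Finally $f_n(u)=\sin^{2n-1}(u)\,Z_n(u,0^{2n-1})$. *)

(* Defs.v *)
From HB Require Import structures.
From mathcomp Require Import all_boot all_order all_algebra.
From mathcomp Require Import all_classical all_reals all_analysis.

Set Implicit Arguments.
Unset Strict Implicit.
Unset Printing Implicit Defensive.

Import Order.TTheory GRing.Theory Num.Theory.
Import numFieldNormedType.Exports.

Local Open Scope classical_set_scope.
Local Open Scope ring_scope.

(* The finite type of integers in {0, 1, -1}; \val injects it into int. *)
Definition asm_entry : finType := seq_sub [:: 0; 1; -1 : int].

Definition alternating (s : seq int) : bool :=
  sorted (fun x y => y == - x) [seq x <- s | x != 0].

Definition asm_line (s : seq int) : bool :=
  (\sum_(x <- s) x == 1) && alternating s.

Definition is_asm (n : nat) (M : 'M[int]_n) : bool :=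
  [forall i, asm_line [seq M i j | j <- enum 'I_n]] &&
  [forall j, asm_line [seq M i j | i <- enum 'I_n]].

Definition ASM (n : nat) : {set 'M[asm_entry]_n} :=
  [set M : 'M[asm_entry]_n | is_asm (map_mx val M)].

Definition row_psum (n : nat) (M : 'M[int]_n) (i j : 'I_n) : int :=
  \sum_(l < n | (l <= j)%N) M i l.

Definition col_psum (n : nat) (M : 'M[int]_n) (i j : 'I_n) : int :=
  \sum_(l < n | (l <= i)%N) M l j.

Definition wt_a (R : realType) (u : R) : R :=
  2 / Num.sqrt 3 * sin (pi / 3 + u).

Definition wt_b (R : realType) (u : R) : R :=
  2 / Num.sqrt 3 * sin (pi / 3 - u).

Definition vertex_weight (R : realType) (n : nat) (x y : 'I_n -> R)
    (M : 'M[int]_n) (i j : 'I_n) : R :=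
  if M i j != 0 then 1
  else if row_psum M i j == col_psum M i j then wt_a (x i - y j)
  else wt_b (x i - y j).

Definition partition_function (R : realType) (n : nat) (x y : 'I_n -> R) : R :=
  \sum_(M in ASM n) \prod_i \prod_j vertex_weight x y (map_mx val M) i j.

(* Z_n at the spectral parameters listed in v, meant for size v = 2 n: the
   first n terms are x_1, ..., x_n and the last n are y_1, ..., y_n. *)
Definition Zn (R : realType) (n : nat) (v : seq R) : R :=
  partition_function (fun i : 'I_n => v`_i) (fun j : 'I_n => v`_(n + j)).

Definition fn (R : realType) (n : nat) (u : R) : R :=
  sin u ^+ (2 * n - 1) * Zn n (u :: nseq (2 * n - 1) 0).

(* f_n^(j) is taken in column j because columns are numbered from 0. *)
Definition fn_derivative_mx (R : realType) (n k : nat) (u : k.-tuple R)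
    : 'M[R]_k :=
  \matrix_(i < k, j < k) ((fn n)^`(j))%classic (tnth u i).

Definition sin_vandermonde (R : realType) (k : nat) (u : k.-tuple R) : R :=
  \prod_(i < k) \prod_(j < k | (i < j)%N) sin (tnth u i - tnth u j).

Definition zeta (R : realType) (n k : nat) : R :=
  (#|ASM n|%:R ^+ (k - 1) * \prod_(1 <= j < k) (2 * n - j)%:R ^+ (k - j))^-1.

Definition hyperfactorial (m : nat) : nat := \prod_(1 <= k < m.+1) k ^ k.

(* Main.v *)
(** Write [Z] as a product of row transfer matrices. The Yang-Baxter equation
makes it symmetric in the [x]'s and, after transposition, in the [y]'s. Let [F t]
be [Z] with one parameter replaced by [t], times [sin (t - w)] for each of the
[2 n - 1] other parameters [w]; it is a homogeneous trigonometric polynomial of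
degree [3 n - 2]. If the parameter is an [x], then at [t = y_j + pi / 3] and at
[t = y_j - pi / 3] a corner vertex freezes and both values reduce to the same
[Z] of size [n - 1], so that [F (y_j + pi / 3) + F (y_j - pi / 3) = 0].
Therefore [F t + F (t + 2 pi / 3) + F (t + 4 pi / 3)] has [3 n] zeros modulo [pi]
and vanishes identically, i.e. [F] only has frequencies not divisible by 3.
These form a space of dimension [2 n] on which the jet of order [2 n] at 0 is
injective, so its elements vanishing to order [2 n - k] at 0 are the combinations
of the first [k] derivatives of [f_n].

The formula follows by induction on [k], for all placements of the parameters at
once, so that the symmetry between [x]'s and [y]'s is not needed. As a function
of any single [u_i], the difference of the two sides is a combination of [k - 1]
derivatives of [f_n], the last coefficient being cancelled by the formula for
[k - 1]; and it vanishes when [u_i] meets another [u_j]. Since [k - 1] functions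
are linearly dependent on [k] points, it is zero. *)

Require Import Defs.
From mathcomp Require Import all_boot all_order all_algebra.
From mathcomp Require Import all_classical all_reals all_analysis.
From mathcomp Require Import ring lra zify.

Set Implicit Arguments.
Unset Strict Implicit.
Unset Printing Implicit Defensive.

Import Order.TTheory GRing.Theory Num.Theory.
Import numFieldNormedType.Exports.

Local Open Scope ring_scope.

(** * Homogeneous trigonometric polynomials *)

(** Homogeneous polynomials of degree [d] in [cos t] and [sin t]. Homogeneity fixes the parity under
    [t + pi], and a nonzero one has at most [d] zeros modulo [pi]. *)
Fixpoint trig_poly (R : realType) (d : nat) (g : R -> R) : Prop :=
  if d is d'.+1 then exists g1 g2, [/\ trig_poly d' g1, trig_poly d' g2 &
    forall t, g t = cos t * g1 t + sin t * g2 t]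
  else exists c, forall t, g t = c.

Lemma trig_poly_ext (R : realType) d (g h : R -> R) :
  (forall t, g t = h t) -> trig_poly d h -> trig_poly d g.
Proof.
case: d => [|d] gh /=; first by move=> [c hc]; exists c => t; rewrite gh.
by move=> [g1 [g2 [? ? e]]]; exists g1, g2; split=> // t; rewrite gh.
Qed.

Lemma trig_poly_zero (R : realType) d : trig_poly d (fun=> 0 : R).
Proof.
elim: d => [|d IH] /=; first by exists 0.
by exists (fun=> 0), (fun=> 0); split=> // t; rewrite !mulr0 addr0.
Qed.

Lemma trig_poly_add (R : realType) d (g h : R -> R) :
  trig_poly d g -> trig_poly d h -> trig_poly d (fun t => g t + h t).
Proof.
elim: d g h => [|d IH] g h /=.
  by move=> [c gc] [e he]; exists (c + e) => t; rewrite gc he.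
move=> [g1 [g2 [? ? eg]]] [h1 [h2 [? ? eh]]].
exists (fun t => g1 t + h1 t), (fun t => g2 t + h2 t).
by split; [exact: IH|exact: IH|] => t; rewrite eg eh; ring.
Qed.

Lemma trig_poly_scale (R : realType) d c (g : R -> R) :
  trig_poly d g -> trig_poly d (fun t => c * g t).
Proof.
elim: d g => [|d IH] g /=; first by move=> [e ge]; exists (c * e) => t; rewrite ge.
move=> [g1 [g2 [? ? eg]]]; exists (fun t => c * g1 t), (fun t => c * g2 t).
by split; [exact: IH|exact: IH|] => t; rewrite eg; ring.
Qed.

Lemma trig_poly_mul (R : realType) d e (g h : R -> R) :
  trig_poly d g -> trig_poly e h -> trig_poly (d + e) (fun t => g t * h t).
Proof.
elim: d g => [|d IH] g /=.
  move=> [c gc] hh; apply: trig_poly_ext (trig_poly_scale c hh) => t.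
  by rewrite gc.
move=> [g1 [g2 [? ? eg]]] hh.
exists (fun t => g1 t * h t), (fun t => g2 t * h t).
by split; [exact: IH|exact: IH|] => t; rewrite eg; ring.
Qed.

Lemma trig_poly_cst (R : realType) (c : R) : trig_poly 0 (fun=> c).
Proof. by exists c. Qed.

(** This is what permits raising a degree by 2 without leaving homogeneous polynomials. *)
Lemma trig_poly_one2 (R : realType) : trig_poly 2 (fun=> 1 : R).
Proof.
exists cos, sin; split=> [||t]; last by rewrite -!expr2 cos2Dsin2.
- by exists (fun=> 1), (fun=> 0); split; try exact: trig_poly_cst; move=> t; ring.
- by exists (fun=> 0), (fun=> 1); split; try exact: trig_poly_cst; move=> t; ring.
Qed.

Lemma trig_poly_raise2 (R : realType) d (g : R -> R) :
  trig_poly d g -> trig_poly d.+2 g.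
Proof.
move=> /(trig_poly_mul (trig_poly_one2 R)); apply: trig_poly_ext => t.
by rewrite mul1r.
Qed.

Lemma trig_poly_sinB (R : realType) (c : R) : trig_poly 1 (fun t => sin (t - c)).
Proof.
exists (fun=> - sin c), (fun=> cos c); split; try exact: trig_poly_cst.
by move=> t; rewrite sinB; ring.
Qed.

Lemma trig_poly_sinBl (R : realType) (c : R) : trig_poly 1 (fun t => sin (c - t)).
Proof.
exists (fun=> sin c), (fun=> - cos c); split; try exact: trig_poly_cst.
by move=> t; rewrite sinB; ring.
Qed.

Lemma trig_poly_shift (R : realType) d (g : R -> R) c :
  trig_poly d g -> trig_poly d (fun t => g (t + c)).
Proof.
elim: d g => [|d IH] g /=; first by move=> [e ge]; exists e => t; rewrite ge.
move=> [g1 [g2 [/IH h1 /IH h2 eg]]].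
exists (fun t => cos c * g1 (t + c) + sin c * g2 (t + c)),
       (fun t => - sin c * g1 (t + c) + cos c * g2 (t + c)).
split=> [||t]; try by apply: trig_poly_add; apply: trig_poly_scale.
by rewrite eg cosD sinD; ring.
Qed.

Lemma trig_poly_opp (R : realType) d (g : R -> R) :
  trig_poly d g -> trig_poly d (fun t => g (- t)).
Proof.
elim: d g => [|d IH] g /=; first by move=> [e ge]; exists e => t; rewrite ge.
move=> [g1 [g2 [/IH h1 /IH h2 eg]]].
exists (fun t => g1 (- t)), (fun t => - 1 * g2 (- t)).
by split=> [//||t]; [exact: trig_poly_scale|rewrite eg cosN sinN; ring].
Qed.

Lemma trig_poly_prod (R : realType) (I : Type) (s : seq I) (F : I -> R -> R) :
  (forall i, trig_poly 1 (F i)) ->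
  trig_poly (size s) (fun t => \prod_(i <- s) F i t).
Proof.
move=> hF; elim: s => [|i s IH] /=.
  by apply: trig_poly_ext (trig_poly_cst 1) => t; rewrite big_nil.
apply: trig_poly_ext (trig_poly_mul (hF i) IH) => t.
by rewrite big_cons.
Qed.

Lemma trig_polyDpi (R : realType) d (g : R -> R) t :
  trig_poly d g -> g (t + pi) = (-1) ^+ d * g t.
Proof.
elim: d g => [|d IH] g /=; first by move=> [c gc]; rewrite !gc mul1r.
move=> [g1 [g2 [/IH e1 /IH e2 eg]]].
by rewrite !eg cosDpi sinDpi e1 e2 exprS; ring.
Qed.

(** At 0 only the cosine term survives, so [g1] vanishes there too; the induction splits a sine off
    [g1], and the other term carries one already. *)
Lemma trig_poly_factor0 (R : realType) d (g : R -> R) :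
  trig_poly d.+1 g -> g 0 = 0 ->
  exists2 h, trig_poly d h & forall t, g t = sin t * h t.
Proof.
elim: d g => [|d IH] g [g1 [g2 [h1 h2 eg]]] g0.
  exists g2 => // t; rewrite eg.
  case: h1 => c hc; move: g0; rewrite eg cos0 sin0 !hc mul0r addr0 mul1r => ->.
  by rewrite mulr0 add0r.
have g10 : g1 0 = 0 by move: g0; rewrite eg cos0 sin0 mul0r addr0 mul1r.
have [h Th eh] := IH _ h1 g10.
exists (fun t => cos t * h t + sin t * 0 + g2 t); last first.
  by move=> t; rewrite eg eh; ring.
apply: trig_poly_add => //; exists h, (fun=> 0); split=> //.
exact: trig_poly_zero.
Qed.

Lemma trig_poly_factor (R : realType) d (g : R -> R) c :
  trig_poly d.+1 g -> g c = 0 ->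
  exists2 h, trig_poly d h & forall t, g t = sin (t - c) * h t.
Proof.
move=> /(trig_poly_shift c) Tg gc.
have [|h Th eh] := trig_poly_factor0 Tg; first by rewrite add0r.
exists (fun t => h (t - c)); first exact: trig_poly_shift.
by move=> t; rewrite -eh subrK.
Qed.

(** Each zero splits off a factor [sin (t - c)] that vanishes at none of the remaining points, so
    more than [d] zeros distinct modulo [pi] exhaust the degree. *)
Lemma trig_poly_eq0 (R : realType) d (g : R -> R) (s : seq R) :
  trig_poly d g -> (d < size s)%N ->
  pairwise (fun x y => sin (x - y) != 0) s ->
  (forall c, c \in s -> g c = 0) -> forall t, g t = 0.
Proof.
elim: s d g => [|c s IH] [|d] g //= Tg ds /andP[cs ps] gs t.
  by case: Tg => e ge; rewrite ge -(ge c) gs ?mem_head.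
have [h Th eg] := trig_poly_factor Tg (gs c (mem_head _ _)).
rewrite eg (IH d h) ?mulr0// => x xs.
have /allP/(_ x xs) ncx := cs.
have := gs x; rewrite inE xs orbT => /(_ isT) /eqP.
rewrite eg mulf_eq0 => /orP[|/eqP//].
by rewrite -opprB sinN oppr_eq0 (negbTE ncx).
Qed.

Lemma sin_frac_neq0 (R : realType) (d i j : nat) :
  (i < j)%N -> (j <= d)%N ->
  sin (pi * (i.+1%:R / d.+2%:R) - pi * (j.+1%:R / d.+2%:R) : R) != 0.
Proof.
move=> ij jd; rewrite -opprB sinN oppr_eq0; apply: lt0r_neq0.
have dp : (0 < d.+2%:R :> R) by rewrite ltr0n.
apply: sin_gt0_pi; rewrite -mulrBr -mulrBl -natrB ?ltnS; last exact: ltnW.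
have p0 := @pi_gt0 R.
apply/andP; split.
  by rewrite mulr_gt0// divr_gt0// ltr0n subn_gt0.
rewrite -[ltRHS]mulr1 ltr_pM2l// ltr_pdivrMr// mul1r ltr_nat.
by lia.
Qed.

(** An algebraic substitute for continuity: an identity known away from the zeros of [sin (t - c)]
    holds everywhere. *)
Lemma trig_poly_cancel (R : realType) d (g : R -> R) c :
  trig_poly d g -> (forall t, sin (t - c) * g t = 0) -> forall t, g t = 0.
Proof.
move=> Tg hg.
(* These are [d + 1] points strictly between [c] and [c + pi], where the sine can be cancelled. *)
pose s := [seq c + pi * (i.+1%:R / d.+2%:R) | i <- iota 0 d.+1].
apply: (trig_poly_eq0 (s := s) Tg).
- by rewrite size_map size_iota.
- rewrite pairwise_map; apply/(pairwiseP 0%N) => i j.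
  rewrite !inE size_iota => id jd ij; rewrite (nth_iota 0 0 id) (nth_iota 0 0 jd) !add0n /=.
  rewrite opprD addrACA subrr add0r.
  exact: sin_frac_neq0.
- move=> x /mapP[i]; rewrite mem_iota add0n => /andP[_ id] ->.
  have /eqP := hg (c + pi * (i.+1%:R / d.+2%:R)).
  rewrite addrAC subrr add0r mulf_eq0 => /orP[|/eqP//].
  have dp : (0 < d.+2%:R :> R) by rewrite ltr0n.
  rewrite gt_eqF//; apply: sin_gt0_pi; apply/andP; split.
    by rewrite mulr_gt0 ?pi_gt0// divr_gt0// ltr0n.
  by rewrite -[ltRHS]mulr1 ltr_pM2l ?pi_gt0// ltr_pdivrMr// mul1r ltr_nat ltnS.
Qed.

Lemma trig_poly_derive (R : realType) d (g : R -> R) : trig_poly d g ->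
  exists2 g' : R -> R, trig_poly d g' & forall t : R, is_derive t (1 : R) g (g' t).
Proof.
elim: d g => [|d IH] g.
  move=> [c gc]; exists (fun=> 0); first exact: trig_poly_cst.
  move=> t; have -> : g = cst c by apply/funext.
  exact: is_derive_cst.
move=> [g1 [g2 [T1 T2 eg]]].
have [g1' T1' d1] := IH _ T1; have [g2' T2' d2] := IH _ T2.
exists (fun t => cos t * (g1' t + g2 t) + sin t * (-1 * g1 t + g2' t)).
  exists (fun t => g1' t + g2 t), (fun t => -1 * g1 t + g2' t).
  by split=> //; apply: trig_poly_add => //; apply: trig_poly_scale.
move=> t; have -> : g = (@cos R) * g1 + (@sin R) * g2 by apply/funext.
have := is_deriveD (is_deriveM (is_derive_cos t) (d1 t))
                   (is_deriveM (is_derive_sin t) (d2 t)).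
move=> /is_derive_eq; apply; rewrite /GRing.scale /=; ring.
Qed.

(** Differentiating [sin t ^+ r.+1 * h t] gives [sin t ^+ r * k t] with [k 0 = r.+1 * h 0];
    iterating accumulates the factorial. *)
Lemma trig_poly_sin_order (R : realType) r d (h : R -> R) : trig_poly d h ->
  (forall m, (m < r)%N -> derive1n m (fun t => sin t ^+ r * h t) 0 = 0) /\
  derive1n r (fun t => sin t ^+ r * h t) 0 = r`!%:R * h 0.
Proof.
elim: r d h => [|r IH] d h Th; first by split=> //=; rewrite !mul1r.
have [h' Th' dh] := trig_poly_derive Th.
pose k t := cos t * (r.+1%:R * h t) + sin t * h' t.
have Tk : trig_poly d.+1 k.
  by exists (fun t => r.+1%:R * h t), h'; split=> //; apply: trig_poly_scale.
have dk : derive1 (fun t => sin t ^+ r.+1 * h t) = fun t => sin t ^+ r * k t.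
  apply/funext => t; rewrite derive1E.
  have -> : (fun t => sin t ^+ r.+1 * h t) = (@sin R) ^+ r.+1 * h.
    by rewrite mulrfctE exprfctE.
  rewrite derive_val /GRing.scale /= /k exprS.
  by rewrite mulrfctE exprfctE; ring.
have [k0 kr] := IH _ _ Tk; split=> [[|m] mr|].
- by rewrite /= sin0 expr0n mul0r.
- by rewrite /derive1n iterSr dk; apply: k0.
rewrite /derive1n iterSr dk -/(derive1n r _) kr /k cos0 sin0 factS natrM.
ring.
Qed.

(** * Yang-Baxter equation and commutation of rows *)

Lemma cos_pi_third (R : realType) : cos (pi / 3 : R) = 2^-1.
Proof.
set c := cos _.
have c0 : 0 < c.
  by apply: cos_gt0_pihalf; have := @pi_gt0 R; lra.
have : cos (pi / 3 + pi / 3 + pi / 3 : R) = -1.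
  by rewrite -[RHS]cospi; congr cos; field.
rewrite !cosD !sinD -/c; move: (cos2Dsin2 (pi / 3 : R)); rewrite -/c.
move: (sin _) => s h e.
(* Tripling the angle gives [4 c ^ 3 - 3 c = -1], which factors in this way; positivity of [c]
   excludes the root -1. *)
have /eqP : (c + 1) * (c - 2^-1) ^+ 2 = 0.
  transitivity (((c * c - s * s) * c - (s * c + c * s) * s + 1) / 4
    + 3 * c / 4 * (c ^+ 2 + s ^+ 2 - 1)); first by field.
  by rewrite e h; field.
rewrite mulf_eq0 gt_eqF ?addr_gt0//= expf_eq0/= subr_eq0 => /eqP //.
Qed.

Lemma sqrt3_gt0 (R : realType) : 0 < Num.sqrt 3 :> R.
Proof. by rewrite sqrtr_gt0. Qed.

Lemma sin_pi_third (R : realType) : sin (pi / 3 : R) = Num.sqrt 3 / 2.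
Proof.
have s0 : 0 < sin (pi / 3 : R).
  by apply: sin_gt0_pi; have := @pi_gt0 R; lra.
have := sin2cos2 (pi / 3 : R); rewrite cos_pi_third => e.
have t0 : 0 <= Num.sqrt 3 / 2 :> R by rewrite divr_ge0// ltW// sqrt3_gt0.
apply/eqP; rewrite -(@eqrXn2 _ 2 _ _ isT (ltW s0) t0).
by rewrite e expr_div_n sqr_sqrtr//; apply/eqP; field.
Qed.

Lemma wt_aE (R : realType) (u : R) :
  wt_a u = cos u + (Num.sqrt 3)^-1 * sin u.
Proof.
rewrite /wt_a sinD sin_pi_third cos_pi_third.
by field; rewrite gt_eqF// sqrt3_gt0.
Qed.

Lemma wt_aN (R : realType) (u : R) : wt_a (- u) = wt_b u.
Proof. by []. Qed.

Lemma wt_bE (R : realType) (u : R) :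
  wt_b u = cos u - (Num.sqrt 3)^-1 * sin u.
Proof. by rewrite -wt_aN wt_aE cosN sinN mulrN. Qed.

(** The scalar identities behind the Yang-Baxter equation at this crossing parameter, where turning
    vertices have weight 1; [q] is an entry of the R-matrix. *)
Lemma ice_yang_baxter (R : realType) (u v : R) :
  let q := 2 / Num.sqrt 3 * sin (u - v) in
  [/\ wt_a u * wt_b v - wt_a v * wt_b u = q,
      wt_a (u - v) * wt_a u = wt_a v + wt_b u * q &
      wt_a (u - v) * wt_b v = wt_b u + wt_a v * q].
Proof.
move=> q; have s0 : Num.sqrt 3 != 0 :> R by rewrite gt_eqF// sqrt3_gt0.
have t2 : ((Num.sqrt 3)^-1 : R) ^+ 2 = 3^-1 by rewrite exprVn sqr_sqrtr.
rewrite /q !wt_aE !wt_bE !sinB !cosB.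
move: (cos2Dsin2 u) (cos2Dsin2 v) t2.
move: (cos u) (sin u) (cos v) (sin v) (Num.sqrt 3)^-1 => c s c' s' t hu hv ht.
split.
- ring.
- apply/eqP; rewrite -subr_eq0; apply/eqP.
  transitivity ((c ^+ 2 + s ^+ 2 - 1) * (c' + t * s')
    + (3 * t ^+ 2 - 1) * s * (s * c' - c * s')); first ring.
  by rewrite hu ht; field.
- apply/eqP; rewrite -subr_eq0; apply/eqP.
  transitivity ((c' ^+ 2 + s' ^+ 2 - 1) * (c - t * s)
    - (3 * t ^+ 2 - 1) * s' * (s * c' - c * s')); first ring.
  by rewrite hv ht; field.
Qed.

(* An edge state is a boolean; [h] enters a vertex from the left, [a] from
   above, and [b] leaves it below: the right edge is then [ice_next h a b], and
   the weight is 0 when the ice rule cannot be satisfied.  In [row_wt] below,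
   [e] is the prescribed last horizontal edge. *)
Definition ice_wt (R : realType) (u : R) (h a b : bool) : R :=
  if a == b then if h == a then wt_a u else wt_b u else (h == a)%:R.

Definition ice_next (h a b : bool) : bool := if a == b then h else b.

Fixpoint row_wt (R : realType) (x : R) (e : bool) (ys : seq R) (h : bool)
    (s m : seq bool) : R :=
  match ys, s, m with
  | y :: ys', a :: s', b :: m' =>
    ice_wt (x - y) h a b * row_wt x e ys' (ice_next h a b) s' m'
  | _, _, _ => (h == e)%:R
  end.

Fixpoint sum_bits (R : nmodType) (n : nat) (F : seq bool -> R) : R :=
  if n is n'.+1 then
    sum_bits n' (fun m => F (false :: m)) + sum_bits n' (fun m => F (true :: m))
  else F [::].

Lemma eq_sum_bits (R : nmodType) n (F G : seq bool -> R) :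
  (forall m, size m = n -> F m = G m) -> sum_bits n F = sum_bits n G.
Proof.
elim: n F G => [|n IH] F G FG /=; first exact: FG.
by congr (_ + _); apply: IH => m sm; apply: FG; rewrite /= sm.
Qed.

Lemma sum_bitsZ (R : pzRingType) n (c : R) F :
  sum_bits n (fun m => c * F m) = c * sum_bits n F.
Proof. by elim: n F => [//|n IH] F /=; rewrite !IH mulrDr. Qed.

Lemma sum_bitsD (R : nmodType) n (F G : seq bool -> R) :
  sum_bits n (fun m => F m + G m) = sum_bits n F + sum_bits n G.
Proof. by elim: n F G => [//|n IH] F G /=; rewrite !IH addrACA. Qed.

Lemma sum_bits0 (R : nmodType) n : sum_bits n (fun=> 0 : R) = 0.
Proof. by elim: n => [//|n IH] /=; rewrite !IH addr0. Qed.

Lemma exchange_sum_bits (R : nmodType) n p (F : seq bool -> seq bool -> R) :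
  sum_bits n (fun m => sum_bits p (F m)) =
  sum_bits p (fun k => sum_bits n (F^~ k)).
Proof. by elim: n F => [//|n IH] F /=; rewrite !IH sum_bitsD. Qed.

Lemma sum_bits_rcons (R : nmodType) n (F : seq bool -> R) :
  sum_bits n.+1 F =
  sum_bits n (fun m => F (rcons m false)) + sum_bits n (fun m => F (rcons m true)).
Proof.
elim: n F => [//|n IH] F.
have -> : sum_bits n.+2 F = sum_bits n.+1 (fun m => F (false :: m)) +
    sum_bits n.+1 (fun m => F (true :: m)) by [].
rewrite (IH (fun m => F (false :: m))) (IH (fun m => F (true :: m))).
by rewrite addrACA.
Qed.

Lemma sum_bits_delta (R : pzRingType) n b (F : seq bool -> R) :
  sum_bits n (fun m => (m == nseq n b)%:R * F m) = F (nseq n b).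
Proof.
elim: n F => [|n IH] F; first by rewrite /= mul1r.
rewrite [LHS]/= [nseq _ _]/=.
case: b IH => IH.
- rewrite (eq_sum_bits (G := fun=> 0)) ?sum_bits0 ?add0r; last first.
    by move=> m _; rewrite eqseq_cons mul0r.
  by rewrite -[RHS](IH (fun m => F (true :: m))); apply: eq_sum_bits => m _;
    rewrite eqseq_cons.
- rewrite [X in _ + X](eq_sum_bits (G := fun=> 0)) ?sum_bits0 ?addr0; last first.
    by move=> m _; rewrite eqseq_cons mul0r.
  by rewrite -[RHS](IH (fun m => F (false :: m))); apply: eq_sum_bits => m _;
    rewrite eqseq_cons.
Qed.

(** Edge bits stand for partial sums: [R] on horizontal edges, [C] on vertical ones. The domain wall
    boundary lets every row enter with [false] and leave with [true], and makes all bottom edges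
    [true]; [s] holds the top edges. *)
Fixpoint transfer (R : realType) (xs ys : seq R) (s : seq bool) : R :=
  if xs is x :: xs' then
    sum_bits (size ys) (fun m => row_wt x true ys false s m * transfer xs' ys m)
  else (s == nseq (size ys) true)%:R.

Definition ice_sum (R : realType) (xs ys : seq R) : R :=
  transfer xs ys (nseq (size ys) false).

Definition two_rows (R : realType) (x x' : R) (ys : seq R) (h h' : bool)
    (s s' : seq bool) : R :=
  sum_bits (size ys) (fun m => row_wt x true ys h s m * row_wt x' true ys h' m s').

Lemma two_rows_cons (R : realType) (x x' y : R) ys h h' a b s s' :
  two_rows x x' (y :: ys) h h' (a :: s) (b :: s') =
  ice_wt (x - y) h a false * ice_wt (x' - y) h' false b *
    two_rows x x' ys (ice_next h a false) (ice_next h' false b) s s' +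
  ice_wt (x - y) h a true * ice_wt (x' - y) h' true b *
    two_rows x x' ys (ice_next h a true) (ice_next h' true b) s s'.
Proof.
by rewrite /two_rows /= -!sum_bitsZ; congr (_ + _); apply: eq_sum_bits => m _;
  rewrite mulrACA.
Qed.

(* The R-matrix acting on the two horizontal edges has the entries
   [wt_a (x - x')], [1] and [q]; it intertwines the two orders of the rows. *)
Lemma two_rows_swap (R : realType) (x x' : R) ys s s' :
  size s = size ys -> size s' = size ys ->
  let q := 2 / Num.sqrt 3 * sin (x - x') in
  let r := wt_a (x - x') in
  let V h h' := two_rows x x' ys h h' s s' in
  let W h h' := two_rows x' x ys h h' s s' in
  [/\ r * V false false = r * W false false,
      r * V true true = r * W true true,
      V false true + q * V true false = r * W false true &
      V true false + q * V false true = r * W true false].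
Proof.
elim: ys s s' => [|y ys IH] [|a s] [|b s'] //=.
  by move=> _ _; rewrite /two_rows /= !(mulr0, mul0r, addr0).
move=> [sa] [sb]; have [] := IH _ _ sa sb.
have := ice_yang_baxter (x - y) (x' - y).
have -> : x - y - (x' - y) = x - x' by ring.
set q := 2 / _ * _; set r := wt_a (x - x').
set V := two_rows x x' ys; set W := two_rows x' x ys.
move=> [e1 e2 e3] e4 e5 e6 e7.
rewrite !two_rows_cons -/V -/W /ice_wt /ice_next.
case: a; case: b => /=; rewrite !(mul0r, mul1r, mulr1, mulr0, add0r, addr0);
  split; rewrite // ?[r * (_ + _)]mulrDr ?[r * (_ * W _ _ _ _)]mulrCA
    -?e4 -?e5 -?e6 -?e7 ?[_ * (r * V _ _ _ _)]mulrCA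
    ?[r * (_ * V _ _ _ _)]mulrA ?e2 ?e3 -?e1; ring.
Qed.

(** The left edges of the two rows are both [false] and the right ones both [true], so at either end
    the R-matrix acts by the same scalar [wt_a (x - x')], which cancels. *)
Lemma transfer_swap (R : realType) (x x' : R) s1 s2 ys s :
  size s = size ys -> wt_a (x - x') != 0 ->
  transfer (s1 ++ x :: x' :: s2) ys s = transfer (s1 ++ x' :: x :: s2) ys s.
Proof.
move=> ss rx; elim: s1 s ss => [|z s1 IH] s ss; last first.
  by rewrite !cat_cons /=; apply: eq_sum_bits => m sm; rewrite IH.
have tr2 u v : transfer ([::] ++ u :: v :: s2) ys s =
    sum_bits (size ys) (fun k => two_rows u v ys false false s k * transfer s2 ys k).
  rewrite /=; under eq_sum_bits do rewrite -sum_bitsZ.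
  rewrite exchange_sum_bits; apply: eq_sum_bits => k sk.
  rewrite mulrC -sum_bitsZ; apply: eq_sum_bits => m sm.
  by rewrite mulrA mulrC.
rewrite !tr2; apply: eq_sum_bits => k sk; congr (_ * _).
by have [/(mulfI rx) ? _ _ _] := two_rows_swap x x' ss sk.
Qed.

Arguments trig_poly {R} d g : simpl never.

(** * Degree, symmetry and freezing *)

Lemma trig_poly_wt_a (R : realType) (y : R) : trig_poly 1 (fun x => wt_a (x - y)).
Proof.
apply: trig_poly_ext (trig_poly_scale (2 / Num.sqrt 3) (trig_poly_sinB (y - pi / 3))).
by move=> t; rewrite /wt_a; congr (_ * sin _); ring.
Qed.

Lemma trig_poly_wt_b (R : realType) (y : R) : trig_poly 1 (fun x => wt_b (x - y)).
Proof.
apply: trig_poly_ext (trig_poly_scale (2 / Num.sqrt 3) (trig_poly_sinBl (y + pi / 3))).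
by move=> t; rewrite /wt_b; congr (_ * sin _); ring.
Qed.

(** A vertex contributes degree 1 unless the row turns there. A row that enters with [false] and
    leaves with [true] turns at least once, which saves one degree. *)
Lemma trig_poly_row_wt (R : realType) (ys : seq R) h s m :
  size s = size ys -> size m = size ys ->
  trig_poly (size ys - ~~ h) (fun x => row_wt x true ys h s m).
Proof.
elim: ys h s m => [|y ys IH] h [|a s] [|b m] //=.
  by move=> _ _; exact: trig_poly_cst.
move=> [ss] [sm]; rewrite /ice_wt /ice_next; case: (eqVneq a b) => [ab|nab].
  have wtT : trig_poly 1 (fun x : R => if h == a then wt_a (x - y) else wt_b (x - y)).
    by case: (h == a); [exact: trig_poly_wt_a|exact: trig_poly_wt_b].
  have := trig_poly_mul wtT (IH h _ _ ss sm).
  case: h {wtT} => /=; first by rewrite ?subn0 ?add1n.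
  (* With no column left, the row ends at [false] instead of the prescribed [true] and its weight is
     0. *)
  case: ys IH ss sm => [|y' ys] IH ss sm /=; last by rewrite ?subn1 ?add1n.
  move=> _; apply: trig_poly_ext (trig_poly_zero R 0) => x.
  by rewrite mulr0.
case: (eqVneq h a) => [ha|nha]; last first.
  by apply: trig_poly_ext (trig_poly_zero R _) => x; rewrite mul0r.
have := IH b _ _ ss sm; rewrite ha.
case: a b {ha IH} nab => [] [] //= _.
  case: ys ss sm => [|y' ys] ss sm.
    move=> _; apply: trig_poly_ext (trig_poly_zero R _) => x.
    by rewrite mulr0.
  (* A turn from [true] to [false] has to be undone further on, so two degrees are missing. *)
  rewrite subn1 subn0 /= => /trig_poly_raise2.
  by apply: trig_poly_ext => x; rewrite mul1r.
rewrite subn1 subn0 /=.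
by apply: trig_poly_ext => x; rewrite mul1r.
Qed.

Lemma trig_poly_sum_bits (R : realType) d n (F : R -> seq bool -> R) :
  (forall m, size m = n -> trig_poly d (F ^~ m)) ->
  trig_poly d (fun t => sum_bits n (F t)).
Proof.
elim: n F => [|n IH] F hF /=; first exact: hF.
by apply: trig_poly_add; apply: IH => m sm; apply: hF; rewrite /= sm.
Qed.

Lemma trig_poly_transfer (R : realType) s1 s2 (ys : seq R) s :
  size s = size ys ->
  trig_poly (size ys - 1) (fun t => transfer (s1 ++ t :: s2) ys s).
Proof.
elim: s1 s => [|x s1 IH] s ss /=; apply: trig_poly_sum_bits => m sm.
  apply: trig_poly_ext
    (trig_poly_scale (transfer s2 ys m) (trig_poly_row_wt false ss sm)) => t.
  by rewrite mulrC.
exact/trig_poly_scale/IH.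
Qed.

(* Where [wt_a (x - x')] vanishes, the swap is obtained by continuation in [x]. *)
Lemma transferC (R : realType) (x x' : R) s1 s2 ys s : size s = size ys ->
  transfer (s1 ++ x :: x' :: s2) ys s = transfer (s1 ++ x' :: x :: s2) ys s.
Proof.
move=> ss; apply/eqP; rewrite -subr_eq0; apply/eqP.
pose g t := transfer (s1 ++ t :: x' :: s2) ys s
            + -1 * transfer ((s1 ++ [:: x']) ++ t :: s2) ys s.
have Tg : trig_poly (size ys - 1) g.
  by apply: trig_poly_add; [|apply: trig_poly_scale]; exact: trig_poly_transfer.
have := trig_poly_cancel (c := x' - pi / 3) Tg.
have eg t : g t = transfer (s1 ++ t :: x' :: s2) ys s
                - transfer (s1 ++ x' :: t :: s2) ys s.
  by rewrite /g -catA mulN1r.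
rewrite -eg; apply=> t; rewrite eg.
have k0 : 2 / Num.sqrt 3 != 0 :> R.
  by rewrite mulf_neq0// invr_eq0 gt_eqF// sqrt3_gt0.
have -> : sin (t - (x' - pi / 3)) = (2 / Num.sqrt 3)^-1 * wt_a (t - x').
  by rewrite /wt_a mulrA mulVf// mul1r; congr sin; ring.
have [->|ta] := eqVneq (wt_a (t - x')) 0; first by rewrite mulr0 mul0r.
by rewrite (transfer_swap _ _ ss ta) subrr mulr0.
Qed.

Lemma transfer_front (R : realType) (x : R) s1 s2 ys s : size s = size ys ->
  transfer (s1 ++ x :: s2) ys s = transfer (x :: s1 ++ s2) ys s.
Proof.
move=> ss; elim/last_ind: s1 s2 => [//|s1 z IH] s2.
by rewrite !cat_rcons transferC// IH.
Qed.

(** Under top edges [false], the ice rule forbids a row at [true] to turn: the whole row is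
    frozen. *)
Lemma row_wt_true_zeros (R : realType) (x : R) e ys m : size m = size ys ->
  row_wt x e ys true (nseq (size ys) false) m =
  (m == nseq (size ys) false)%:R * (e%:R * \prod_(y <- ys) wt_b (x - y)).
Proof.
elim: ys m => [|y ys IH] [|b m] //=; first by case: e; rewrite big_nil /= ?mulr1 ?mul1r.
move=> [sm]; rewrite /ice_wt /ice_next big_cons eqseq_cons; case: b => /=.
  by rewrite !mul0r.
by rewrite IH//; ring.
Qed.

(** After a turn the row would stay at [true], against its prescribed last edge [false]. *)
Lemma row_wt_false_zeros (R : realType) (x : R) ys m : size m = size ys ->
  row_wt x false ys false (nseq (size ys) false) m =
  (m == nseq (size ys) false)%:R * \prod_(y <- ys) wt_a (x - y).
Proof.
elim: ys m => [|y ys IH] [|b m] //=; first by rewrite big_nil /= mulr1.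
move=> [sm]; rewrite /ice_wt /ice_next big_cons eqseq_cons; case: b => /=.
  by rewrite row_wt_true_zeros// !mul0r !mulr0.
by rewrite IH//; ring.
Qed.

Lemma row_wt_rcons (R : realType) (x y : R) e ys h a b s m :
  size s = size ys -> size m = size ys ->
  row_wt x e (rcons ys y) h (rcons s a) (rcons m b) =
    row_wt x false ys h s m * (ice_wt (x - y) false a b * (ice_next false a b == e)%:R)
  + row_wt x true ys h s m * (ice_wt (x - y) true a b * (ice_next true a b == e)%:R).
Proof.
elim: ys h s m => [|z ys IH] h [|c s] [|d m] //=.
  by case: h; rewrite /= ?(mul0r, mul1r, add0r, addr0).
by move=> [ss] [sm]; rewrite IH// mulrDr !mulrA.
Qed.

(** Rows enter with [false], so a first column that carries [true] can never turn back. *)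
Lemma transfer_left_true (R : realType) (y : R) xs ys s : size s = size ys ->
  transfer xs (y :: ys) (true :: s) =
  (\prod_(x <- xs) wt_b (x - y)) * transfer xs ys s.
Proof.
elim: xs s => [|x xs IH] s ss; first by rewrite big_nil mul1r /= eqseq_cons.
rewrite big_cons /= /ice_wt /ice_next /=.
rewrite (eq_sum_bits (G := fun=> 0)) ?sum_bits0 ?add0r; last first.
  by move=> m sm; rewrite !mul0r.
by rewrite -sum_bitsZ; apply: eq_sum_bits => m sm; rewrite IH//; ring.
Qed.

(** Rows must leave with [true], which prevents a last column at [true] from turning. *)
Lemma transfer_right_true (R : realType) (y : R) xs ys s : size s = size ys ->
  transfer xs (rcons ys y) (rcons s true) =
  (\prod_(x <- xs) wt_a (x - y)) * transfer xs ys s.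
Proof.
elim: xs s => [|x xs IH] s ss.
  rewrite big_nil mul1r /= size_rcons -[_.+1]addn1 nseqD cats1 eqseq_rcons.
  by rewrite andbT.
rewrite big_cons [LHS]/= size_rcons sum_bits_rcons.
rewrite (eq_sum_bits (G := fun=> 0)) ?sum_bits0 ?add0r; last first.
  by move=> m sm; rewrite row_wt_rcons// /ice_wt /ice_next /= !(mulr0, mul0r, addr0).
rewrite [in RHS]/= -sum_bitsZ; apply: eq_sum_bits => m sm.
by rewrite row_wt_rcons// IH// /ice_wt /ice_next /=; ring.
Qed.

(** With [wt_a] zero at the upper left corner, that vertex must turn; this sends [true] along the
    whole first row and down the whole first column. *)
Lemma ice_sum_left (R : realType) (x y : R) xs ys : wt_a (x - y) = 0 ->
  ice_sum (x :: xs) (y :: ys) =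
  (\prod_(z <- ys) wt_b (x - z)) * (\prod_(z <- xs) wt_b (z - y)) * ice_sum xs ys.
Proof.
move=> axy; rewrite /ice_sum /= /ice_wt /ice_next /= axy.
rewrite (eq_sum_bits (G := fun=> 0)) ?sum_bits0 ?add0r; last first.
  by move=> m sm; rewrite !mul0r.
rewrite -[RHS]mulrA -(transfer_left_true _ _ (size_nseq _ _)).
rewrite -(sum_bits_delta _ _ (fun m => _ * transfer xs (y :: ys) (true :: m))).
by apply: eq_sum_bits => m sm; rewrite row_wt_true_zeros//=; ring.
Qed.

(** With [wt_b] zero at the upper right corner, that vertex must turn; the first row then carries
    [false] up to it, and [true] runs down the last column. *)
Lemma ice_sum_right (R : realType) (x y : R) xs ys : wt_b (x - y) = 0 ->
  ice_sum (x :: xs) (rcons ys y) =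
  (\prod_(z <- ys) wt_a (x - z)) * (\prod_(z <- xs) wt_a (z - y)) * ice_sum xs ys.
Proof.
move=> bxy; rewrite /ice_sum [LHS]/= size_rcons sum_bits_rcons.
rewrite -[_.+1]addn1 nseqD cats1.
rewrite (eq_sum_bits (G := fun=> 0)) ?sum_bits0 ?add0r; last first.
  move=> m sm; rewrite row_wt_rcons ?size_nseq// /ice_wt /ice_next /= bxy.
  by rewrite !(mulr0, mul0r, addr0).
rewrite -[RHS]mulrA -(transfer_right_true _ _ (size_nseq _ _)).
rewrite -(sum_bits_delta _ _ (fun m => _ * transfer xs (rcons ys y) (rcons m true))).
apply: eq_sum_bits => m sm; rewrite row_wt_rcons ?size_nseq// row_wt_false_zeros//.
by rewrite /ice_wt /ice_next /=; ring.
Qed.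

(** * Alternating sign matrices as ice configurations *)

Lemma big_tuple_cons (V : nmodType) (T : finType) n (F : n.+1.-tuple T -> V) :
  \sum_(t : n.+1.-tuple T) F t = \sum_(x : T) \sum_(t : n.-tuple T) F [tuple of x :: t].
Proof.
rewrite pair_big /=.
rewrite (reindex (fun p : T * n.-tuple T => [tuple of p.1 :: p.2])) //=.
exists (fun t : n.+1.-tuple T => (thead t, [tuple of behead t])) => [[x t] _|t _] /=.
  by congr pair; apply/val_inj.
by rewrite -tuple_eta.
Qed.

Lemma sum_bitsE (V : nmodType) n (F : seq bool -> V) :
  sum_bits n F = \sum_(m : n.-tuple bool) F m.
Proof.
elim: n F => [|n IH] F /=.
  by rewrite (big_pred1 [tuple]) // => t; apply/esym/eqP; rewrite tuple0.
by rewrite big_tuple_cons big_bool /= !IH addrC.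
Qed.

Fixpoint path_wt (R : realType) (xs ys : seq R) (s : seq bool)
    (c : seq (seq bool)) : R :=
  match xs, c with
  | x :: xs', m :: c' => row_wt x true ys false s m * path_wt xs' ys m c'
  | _, _ => (s == nseq (size ys) true)%:R
  end.

Lemma transferE (R : realType) (xs ys : seq R) s :
  transfer xs ys s =
  \sum_(c : (size xs).-tuple ((size ys).-tuple bool)) path_wt xs ys s (map val c).
Proof.
elim: xs s => [|x xs IH] s.
  by rewrite (big_pred1 [tuple]) // => t; apply/esym/eqP; rewrite tuple0.
rewrite [LHS]/= sum_bitsE big_tuple_cons; apply: eq_bigr => m _.
by rewrite IH big_distrr.
Qed.

Lemma path_wtE (R : realType) (xs ys : seq R) s c : size c = size xs ->
  path_wt xs ys s c = (last s c == nseq (size ys) true)%:R *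
  \prod_(i < size xs)
    row_wt xs`_i true ys false (nth [::] (s :: c) i) (nth [::] c i).
Proof.
elim: xs s c => [|x xs IH] s [|m c] //=; first by rewrite big_ord0 mulr1.
by move=> [sc]; rewrite IH// big_ord_recl /= mulrCA.
Qed.

(** The ice rule along a line: [z] is the edge state entering it, [e] the state leaving it, and the
    entries of [d] are the changes at the vertices. *)
Fixpoint ice_path (e z : int) (d : seq int) : bool :=
  if d is x :: d' then (z + x \in [:: 0; 1]) && ice_path e (z + x) d' else z == e.

Lemma ice_pathP e z d :
  reflect ((forall j, (j < size d)%N -> z + \sum_(x <- take j.+1 d) x \in [:: 0; 1])
    /\ z + \sum_(x <- d) x = e) (ice_path e z d).
Proof.
elim: d z => [|x d IH] z /=.
  by apply: (iffP eqP) => [->|[_ <-]]; rewrite ?big_nil ?addr0.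
apply: (iffP andP) => [[zx /IH[h1 h2]]|[h1 h2]].
  split=> [[|j] jd|]; last by rewrite big_cons addrA.
    by rewrite take0 big_seq1.
  by rewrite big_cons addrA; exact: h1.
split; first by have := h1 0%N isT; rewrite take0 big_seq1.
apply/IH; split=> [j jd|]; last by rewrite -h2 big_cons addrA.
by have := h1 j.+1 jd; rewrite big_cons addrA.
Qed.

Lemma ice_path_end e z d : ice_path e z d -> z \in [:: 0; 1] -> e \in [:: 0; 1].
Proof.
elim: d z => [|x d IH] z /=; first by move=> /eqP ->.
by case/andP=> zx /IH h _; exact: h.
Qed.

(** The starting point of [path] is a virtual entry: at partial sum 1 the last nonzero entry was 1,
    and at partial sum 0 it is taken to be -1. *)
Lemma ice_path_alternating e (h : bool) d : {subset d <= [:: 0; 1; -1]} ->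
  ice_path e h%:Z d = (h%:Z + \sum_(x <- d) x == e) &&
    path (fun x y => y == - x) (if h then 1 else -1) [seq x <- d | x != 0].
Proof.
elim: d h => [|x d IH] h sd /=; first by rewrite big_nil addr0 andbT.
have sd' : {subset d <= [:: 0; 1; -1]} by move=> y yd; rewrite sd// inE yd orbT.
have := sd _ (mem_head _ _); rewrite big_cons addrA !inE => /or3P[] /eqP -> /=.
- by rewrite addr0 IH//; case: h.
- case: h => /=; first by rewrite andbF.
  by rewrite add0r (IH true).
- case: h => /=; last by rewrite andbF.
  by rewrite subrr (IH false).
Qed.

(** Alternation leaves the sign of the first nonzero entry open; the total 1 forces it to be 1. *)
Lemma asm_line_ice_path d : {subset d <= [:: 0; 1; -1]} ->
  asm_line d = ice_path 1 0 d.
Proof.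
move=> sd; rewrite (ice_path_alternating 1 false sd) add0r /asm_line /Defs.alternating.
case: eqP => //= s1.
(* If the first nonzero entry were -1, the sums started at 1 would end at 2. *)
have := ice_path_alternating 2 true sd; rewrite s1 eqxx /=.
case ef: [seq x <- d | x != 0] => [|y p] //=.
have : y \in [seq x <- d | x != 0] by rewrite ef mem_head.
rewrite mem_filter => /andP[y0 /sd]; rewrite !inE (negbTE y0) /=.
case/orP => /eqP -> //= e2; case pp: (path _ _ _) e2 => // /ice_path_end.
by case/(_ isT)/orP.
Qed.

(** A matrix entry is the column partial sum below it minus the one above it; [s] and [m] are the
    vertical edges above and below a row. *)
Definition bit_diff (s m : seq bool) : seq int :=
  [seq (nat_of_bool p.2)%:Z - (nat_of_bool p.1)%:Z | p <- zip s m].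

(** The horizontal edge after a column is [h] plus the row partial sum, which turns the recursive
    weight into an indicator of the ice rule times the vertex weights. *)
Lemma row_wtE (R : realType) (x : R) ys (h : bool) s m :
  size s = size ys -> size m = size ys ->
  row_wt x true ys h s m = (ice_path 1 h%:Z (bit_diff s m))%:R *
  \prod_(j < size ys)
    (if (bit_diff s m)`_j != 0 then 1
     else if h%:Z + \sum_(z <- take j.+1 (bit_diff s m)) z == (nth false m j)%:Z
     then wt_a (x - ys`_j) else wt_b (x - ys`_j)).
Proof.
elim: ys h s m => [|y ys IH] h [|a s] [|b m] //=.
  by move=> _ _; rewrite big_ord0 mulr1; case: h.
move=> [ss] [sm]; rewrite big_ord_recl /= take0 big_seq1.
rewrite IH// /ice_wt /ice_next /bit_diff /=.
set D := map _ _.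
have sumD (k : 'I_(size ys)) (z : int) :
    \sum_(w <- z :: take (bump 0 k) D) w = z + \sum_(w <- take k.+1 D) w.
  by rewrite big_cons.
have e1 (z : int) : \prod_(i < size ys)
   (if D`_i != 0 then 1 else
    if h%:Z + \sum_(w <- z :: take (bump 0 i) D) w == (nth false m i)%:Z
    then wt_a (x - ys`_i) else wt_b (x - ys`_i)) = 
   \prod_(i < size ys)
   (if D`_i != 0 then 1 else
    if (h%:Z + z) + \sum_(w <- take i.+1 D) w == (nth false m i)%:Z
    then wt_a (x - ys`_i) else wt_b (x - ys`_i)).
  by apply: eq_bigr => i _; rewrite sumD addrA.
rewrite e1.
case: a; case: b; case: h {e1} => /=; rewrite ?(subrr, addr0, add0r, mul1r, mul0r)//; ring.
Qed.

Lemma nth_map_enum (T : Type) (z : T) n (f : 'I_n -> T) (i : 'I_n) :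
  nth z [seq f l | l <- enum 'I_n] i = f i.
Proof. by rewrite (nth_map i) ?nth_ord_enum// size_enum_ord. Qed.

Lemma big_take_nth (s : seq int) k : (k <= size s)%N ->
  \sum_(z <- take k s) z = \sum_(0 <= l < k) s`_l.
Proof.
move=> ks; rewrite (big_nth 0) size_takel//.
by apply: eq_big_nat => i /andP[_ ik]; rewrite nth_take.
Qed.

Lemma sum_ord_le (n : nat) (g : nat -> int) (k : 'I_n) :
  \sum_(l < n | (l <= k)%N) g l = \sum_(0 <= l < k.+1) g l.
Proof.
rewrite big_mkord (big_ord_widen n g (ltn_ord k)).
by apply: eq_bigl => l; rewrite ltnS.
Qed.

Lemma sum_ord_take (n : nat) (f : 'I_n -> int) (k : 'I_n) :
  \sum_(l < n | (l <= k)%N) f l =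
  \sum_(z <- take k.+1 [seq f l | l <- enum 'I_n]) z.
Proof.
have sk : (k < size [seq f l | l <- enum 'I_n])%N.
  by rewrite size_map size_enum_ord.
rewrite (big_take_nth sk) -(sum_ord_le (fun l => [seq f l | l <- enum 'I_n]`_l)).
by apply: eq_bigr => l _; rewrite nth_map_enum.
Qed.

Lemma prod_natr_bool (R : comPzSemiRingType) (I : finType) (b : pred I) :
  \prod_i (b i)%:R = [forall i, b i]%:R :> R.
Proof.
case: forallP => [h|/forallP]; first by rewrite big1// => i _; rewrite h.
rewrite negb_forall => /existsP[i /negbTE bi].
by rewrite (bigD1 i)//= bi mul0r.
Qed.

Definition to_asm_entry (z : int) : asm_entry := insubd (SeqSub (mem_head 0 [:: 1; -1])) z.

Lemma to_asm_entryK z : z \in [:: 0; 1; -1] -> val (to_asm_entry z) = z.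
Proof. exact: insubdK. Qed.

Lemma bit_diff_entry (a b : bool) : (b%:Z - a%:Z : int) \in [:: 0; 1; -1].
Proof. by case: a; case: b. Qed.

Definition bits_at (c : seq (seq bool)) (i j : nat) : bool :=
  nth false (nth [::] c i) j.

(** Prepending the top boundary shifts the index, so that the second [bits_at] reads the edge above
    row [i]. *)
Definition asm_of_bits n (c : seq (seq bool)) : 'M[asm_entry]_n :=
  \matrix_(i, j) to_asm_entry ((bits_at c i j)%:Z -
    (bits_at (nseq n false :: c) i j)%:Z).

Definition bits_of_asm n (M : 'M[asm_entry]_n) : n.-tuple (n.-tuple bool) :=
  [tuple [tuple col_psum (map_mx val M) i j == 1 | j < n] | i < n].

Lemma asm_of_bitsE n c i j : map_mx val (asm_of_bits n c) i j =
  (bits_at c i j)%:Z - (bits_at (nseq n false :: c) i j)%:Z.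
Proof. by rewrite !mxE to_asm_entryK// bit_diff_entry. Qed.

Lemma col_psum_asm_of_bits n c i j :
  col_psum (map_mx val (asm_of_bits n c)) i j = (bits_at c i j)%:Z.
Proof.
pose g k := (bits_at (nseq n false :: c) k j)%:Z.
rewrite /col_psum; under eq_bigr do rewrite asm_of_bitsE -/(g _).
rewrite (sum_ord_le (fun l => g l.+1 - g l)) telescope_sumr// /g.
by rewrite {2}/bits_at /= nth_nseq if_same subr0.
Qed.

Lemma bits_at_map n (c : n.-tuple (n.-tuple bool)) (i j : 'I_n) :
  bits_at (map val c) i j = tnth (tnth c i) j.
Proof.
rewrite /bits_at (nth_map (tnth c i)) ?size_tuple//.
by rewrite -!tnth_nth.
Qed.

Lemma asm_of_bitsK n (c : n.-tuple (n.-tuple bool)) :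
  bits_of_asm (asm_of_bits n (map val c)) = c.
Proof.
apply/eq_from_tnth => i; apply/eq_from_tnth => j; rewrite !tnth_mktuple.
by rewrite col_psum_asm_of_bits bits_at_map; case: (tnth _ _).
Qed.

Lemma asm_seq_entries n (M : 'M[asm_entry]_n) (f : 'I_n -> 'I_n * 'I_n) :
  {subset [seq map_mx val M (f l).1 (f l).2 | l <- enum 'I_n] <= [:: 0; 1; -1]}.
Proof. by move=> z /mapP[l _ ->]; rewrite mxE; exact: valP. Qed.

Lemma col_psum_nat n (N : 'M[int]_n) (i j : 'I_n) :
  col_psum N i j = \sum_(0 <= l < i.+1) [seq N l j | l <- enum 'I_n]`_l.
Proof.
by rewrite /col_psum sum_ord_take big_take_nth// size_map size_enum_ord.
Qed.

Lemma asm_col_psum n (M : 'M[asm_entry]_n) (i j : 'I_n) : M \in ASM n ->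
  (col_psum (map_mx val M) i j == 1)%:Z = col_psum (map_mx val M) i j.
Proof.
rewrite inE => /andP[_ /forallP colM].
have := colM j; rewrite (asm_line_ice_path (@asm_seq_entries _ M (fun i => (i, j)))).
move=> /ice_pathP[/(_ i) + _]; rewrite size_map size_enum_ord => /(_ (ltn_ord i)).
by rewrite add0r -sum_ord_take /= -/(col_psum _ _ _) !inE => /orP[] /eqP ->.
Qed.

Lemma bits_of_asmK n (M : 'M[asm_entry]_n) : M \in ASM n ->
  asm_of_bits n (map val (bits_of_asm M)) = M.
Proof.
move=> MA; have cM := fun i j => asm_col_psum i j MA.
apply/matrixP => i j; apply/val_inj.
have := asm_of_bitsE (map val (bits_of_asm M)) i j; rewrite mxE => ->.
rewrite bits_at_map !tnth_mktuple cM [RHS](_ : _ = map_mx val M i j); last by rewrite mxE.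
rewrite -[RHS](nth_map_enum 0 (fun l => map_mx val M l j)) col_psum_nat.
case: i => -[|i] lti /=.
  by rewrite big_nat1 /bits_at /= nth_nseq if_same subr0.
have lti' : (i < n)%N by exact: ltnW.
rewrite [bits_at _ _ _](bits_at_map (bits_of_asm M) (Ordinal lti') j).
rewrite !tnth_mktuple cM col_psum_nat [X in X - _]big_nat_recr//=.
by rewrite addrAC subrr add0r.
Qed.

Lemma sum_ASM (V : nmodType) n (F : 'M[asm_entry]_n -> V) :
  \sum_(M in ASM n) F M =
  \sum_(c : n.-tuple (n.-tuple bool) | asm_of_bits n (map val c) \in ASM n)
    F (asm_of_bits n (map val c)).
Proof.
rewrite (reindex_onto (fun c : n.-tuple (n.-tuple bool) => asm_of_bits n (map val c))
  (@bits_of_asm n)) /=; last exact: bits_of_asmK.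
by apply: eq_bigl => c; rewrite asm_of_bitsK eqxx andbT.
Qed.

Lemma row_asm_of_bits n (c : n.-tuple (n.-tuple bool)) (i : 'I_n) :
  [seq map_mx val (asm_of_bits n (map val c)) i j | j <- enum 'I_n] =
  bit_diff (nth [::] (nseq n false :: map val c) i) (nth [::] (map val c) i).
Proof.
have s1 : size (nth [::] (map val c) i) = n.
  by rewrite (nth_map (tnth c i)) ?size_tuple.
have s0 : size (nth [::] (nseq n false :: map val c) i) = n.
  case: i {s1} => -[|i] lti; rewrite /= ?size_nseq//.
  by rewrite (nth_map [tuple of nseq n false]) ?size_tuple// ltnW.
have sz : size (zip (nth [::] (nseq n false :: map val c) i) (nth [::] (map val c) i)) = n.
  by rewrite size_zip s0 s1 minnn.
apply: (@eq_from_nth _ 0); first by rewrite size_map size_enum_ord size_map sz.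
move=> j; rewrite size_map size_enum_ord => jn.
rewrite (nth_map_enum 0 _ (Ordinal jn)) asm_of_bitsE.
by rewrite (nth_map (false, false)) ?sz// nth_zip ?s0 ?s1.
Qed.

(** Column partial sums are bits by construction, so the column conditions only say that the last
    row of bits is all [true]; the row conditions are the ice rule. *)
Lemma asm_of_bits_in n (c : n.-tuple (n.-tuple bool)) : (0 < n)%N ->
  (asm_of_bits n (map val c) \in ASM n) =
  (last (nseq n false) (map val c) == nseq n true) &&
  [forall i : 'I_n, ice_path 1 0
    (bit_diff (nth [::] (nseq n false :: map val c) i) (nth [::] (map val c) i))].
Proof.
move=> n0; rewrite inE /is_asm andbC; congr (_ && _); last first.
  apply: eq_forallb => i; rewrite -row_asm_of_bits asm_line_ice_path//.
  exact: (@asm_seq_entries _ _ (fun l => (i, l))).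
have ltn1 : (n.-1 < n)%N by rewrite prednK.
have lastE : last (nseq n false) (map val c) = tnth c (Ordinal ltn1).
  rewrite -nth_last size_map size_tuple -[map _ _]/(map val (val c)).
  rewrite (nth_map (tnth c (Ordinal ltn1))) ?size_tuple//.
  by rewrite [in RHS](tnth_nth (tnth c (Ordinal ltn1))).
rewrite lastE.
have colE j : asm_line [seq map_mx val (asm_of_bits n (map val c)) i j | i <- enum 'I_n]
    = tnth (tnth c (Ordinal ltn1)) j.
  rewrite asm_line_ice_path; last first.
    exact: (@asm_seq_entries _ _ (fun l => (l, j))).
  have tot : \sum_(x <- [seq map_mx val (asm_of_bits n (map val c)) i j | i <- enum 'I_n]) x
      = (tnth (tnth c (Ordinal ltn1)) j)%:Z.
    rewrite -bits_at_map -col_psum_asm_of_bits /col_psum sum_ord_take.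
    by rewrite take_oversize// size_map size_enum_ord /= prednK.
  apply/ice_pathP/idP => [[_]|h].
    by rewrite add0r tot; case: (tnth _ _).
  rewrite add0r tot h; split=> // k; rewrite size_map size_enum_ord => kn.
  rewrite add0r -(sum_ord_take _ (Ordinal kn)) -/(col_psum _ _ _).
  by rewrite col_psum_asm_of_bits; case: (bits_at _ _ _).
apply/forallP/eqP => [h|h j].
  apply: (@eq_from_nth _ false); first by rewrite size_tuple size_nseq.
  move=> j; rewrite size_tuple => jn; rewrite nth_nseq jn.
  by have := h (Ordinal jn); rewrite colE (tnth_nth false).
by rewrite colE (tnth_nth false) h nth_nseq ltn_ord.
Qed.

(** Both sides become sums over the vertical edges; the indicators in [path_wtE] and [row_wtE]
    select exactly those that come from alternating sign matrices. *)
Lemma partition_function_ice_sum (R : realType) n (xs ys : seq R) : (0 < n)%N ->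
  size xs = n -> size ys = n ->
  partition_function (fun i : 'I_n => xs`_i) (fun j : 'I_n => ys`_j) = ice_sum xs ys.
Proof.
move=> n0 sx sy; rewrite /partition_function sum_ASM /ice_sum transferE.
rewrite sx sy [LHS]big_mkcond /=; apply: eq_bigr => c _.
rewrite path_wtE ?sx ?size_map ?size_tuple//.
under [in RHS]eq_bigr => i _.
  rewrite row_wtE; last 2 first.
  - rewrite sy; case: i => -[|i] lti; rewrite /= ?size_nseq//.
    by rewrite (nth_map [tuple of nseq n false]) ?size_tuple// ltnW.
  - by rewrite sy (nth_map (tnth c i)) ?size_tuple.
  over.
rewrite big_split /= prod_natr_bool mulrA -natrM mulnb sy.
rewrite asm_of_bits_in//; case: ifP => _; last by rewrite mul0r.
rewrite mul1r; apply: eq_bigr => i _; apply: eq_bigr => j _.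
rewrite -row_asm_of_bits nth_map_enum add0r -sum_ord_take -/(row_psum _ _ _).
by rewrite /vertex_weight col_psum_asm_of_bits.
Qed.

(** * The three-term relation *)

(** Transposition exchanges row and column partial sums, hence keeps the type of each vertex; the
    minus signs preserve the differences of parameters. *)
Lemma partition_functionT (R : realType) n (x y : 'I_n -> R) :
  partition_function x y = partition_function (fun i => - y i) (fun j => - x j).
Proof.
rewrite /partition_function (reindex_inj (@trmx_inj _ n n)) /=.
apply: eq_big => [M|M _].
  by rewrite !inE /is_asm andbC; congr (_ && _); apply: eq_forallb => i;
    congr asm_line; apply: eq_map => j; rewrite !mxE.
rewrite exchange_big; apply: eq_bigr => i _; apply: eq_bigr => j _.
rewrite /vertex_weight !mxE opprK [- _ + _]addrC.
rewrite (_ : row_psum _ j i = col_psum (map_mx val M) i j); last first.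
  by apply: eq_bigr => l _; rewrite !mxE.
rewrite (_ : col_psum _ j i = row_psum (map_mx val M) i j); last first.
  by apply: eq_bigr => l _; rewrite !mxE.
by rewrite [row_psum _ _ _ == _]eq_sym.
Qed.

Lemma Zn_cat (R : realType) n (xs ys : seq R) : (0 < n)%N ->
  size xs = n -> size ys = n -> Zn n (xs ++ ys) = ice_sum xs ys.
Proof.
move=> n0 sx sy; rewrite -(partition_function_ice_sum n0 sx sy) /Zn.
congr partition_function; apply/funext => i; rewrite nth_cat sx ?ltn_ord//.
by rewrite ltnNge leq_addr /= addKn.
Qed.

Lemma ice_sumT (R : realType) (xs ys : seq R) : size xs = size ys ->
  ice_sum xs ys = ice_sum [seq - y | y <- ys] [seq - x | x <- xs].
Proof.
case: ys => [|y ys]; first by move=> /size0nil ->.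
move=> sx; rewrite -(@partition_function_ice_sum _ (size (y :: ys)))//.
rewrite partition_functionT -(@partition_function_ice_sum _ (size (y :: ys))) ?size_map//.
by congr partition_function; apply/funext => i; rewrite (nth_map 0) ?sx.
Qed.

Lemma ice_sum_front (R : realType) (x : R) s1 s2 ys :
  ice_sum (s1 ++ x :: s2) ys = ice_sum (x :: s1 ++ s2) ys.
Proof. by rewrite /ice_sum transfer_front// size_nseq. Qed.

Lemma ice_sum_front_col (R : realType) (y : R) xs s1 s2 :
  size xs = size (s1 ++ y :: s2) ->
  ice_sum xs (s1 ++ y :: s2) = ice_sum xs (y :: s1 ++ s2).
Proof.
move=> sx; rewrite ice_sumT// map_cat /= ice_sum_front -map_cat -map_cons -ice_sumT//.
by rewrite sx /= !size_cat addnS.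
Qed.

Lemma trig_poly_ice_sum (R : realType) s1 s2 (ys : seq R) :
  trig_poly (size ys - 1) (fun t => ice_sum (s1 ++ t :: s2) ys).
Proof. by apply: trig_poly_transfer; rewrite size_nseq. Qed.

Lemma trig_poly_ice_sum_col (R : realType) s1 s2 (xs : seq R) :
  size xs = (size s1 + size s2).+1 ->
  trig_poly (size xs - 1) (fun t => ice_sum xs (s1 ++ t :: s2)).
Proof.
move=> sx.
have := trig_poly_opp (trig_poly_ice_sum [seq - y | y <- s1] [seq - y | y <- s2]
  [seq - x | x <- xs]).
rewrite size_map; apply: trig_poly_ext => t.
by rewrite ice_sumT ?map_cat// size_cat /= addnS.
Qed.

Lemma wt_a_pi3 (R : realType) (y : R) : wt_a (y - pi / 3 - y) = 0.
Proof. by rewrite addrAC subrr add0r /wt_a subrr sin0 mulr0. Qed.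

Lemma wt_b_pi3 (R : realType) (y : R) : wt_b (y + pi / 3 - y) = 0.
Proof. by rewrite addrAC subrr add0r /wt_b subrr sin0 mulr0. Qed.

Definition ice_numerator (R : realType) (xs ys : seq R) (t : R) : R :=
  ice_sum (t :: xs) ys * \prod_(w <- xs ++ ys) sin (t - w).

(** At [y - pi / 3] the upper left corner freezes. At [y + pi / 3] the column of [y] is first moved
    to the right end, and the upper right corner freezes. Both leave the same smaller ice sum, and
    [sin (t - y)] has opposite values. *)
Lemma ice_numerator_pm (R : realType) (xs s1 s2 : seq R) (y : R) :
  size xs = (size s1 + size s2)%N ->
  ice_numerator xs (s1 ++ y :: s2) (y + pi / 3) +
  ice_numerator xs (s1 ++ y :: s2) (y - pi / 3) = 0.
Proof.
move=> sx; rewrite /ice_numerator.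
have prodE t : \prod_(w <- xs ++ s1 ++ y :: s2) sin (t - w) =
    sin (t - y) * \prod_(w <- xs) sin (t - w) * \prod_(w <- s1 ++ s2) sin (t - w).
  by rewrite !big_cat big_cons /=; ring.
have sz t : size (t :: xs) = size (s1 ++ y :: s2) by rewrite /= sx size_cat addnS.
rewrite !ice_sum_front_col// !prodE.
rewrite (ice_sum_left _ _ (wt_a_pi3 y)).
have -> : ice_sum (y + pi / 3 :: xs) (y :: s1 ++ s2) =
    ice_sum (y + pi / 3 :: xs) (rcons (s1 ++ s2) y).
  by rewrite -cats1 ice_sum_front_col ?cats0// /= sx !size_cat /= addn1.
rewrite (ice_sum_right _ _ (wt_b_pi3 y)).
have -> : y + pi / 3 - y = pi / 3 by ring.
have -> : y - pi / 3 - y = - (pi / 3) by ring.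
rewrite sinN.
(* Each frozen weight is paired with the sine factor of the same parameter; between the two points
   every such product changes sign. *)
pose e (f g : R -> R) (s : seq R) := \prod_(z <- s) f z * \prod_(z <- s) g z.
have prod_sign (f g f' g' : R -> R) s : (forall z, f z * g z = - (f' z * g' z)) ->
    e f g s = (-1) ^+ size s * e f' g' s.
  move=> h; rewrite /e -!big_split /= (eq_bigr _ (fun z _ => h z)).
  by elim: s => [|z s IH]; rewrite ?big_nil ?mulr1// !big_cons IH exprS; ring.
have hx := @prod_sign (fun z => wt_a (z - y)) (fun w => sin (y + pi / 3 - w))
  (fun z => wt_b (z - y)) (fun w => sin (y - pi / 3 - w)) xs.
have hs := @prod_sign (fun z => wt_a (y + pi / 3 - z)) (fun w => sin (y + pi / 3 - w))
  (fun z => wt_b (y - pi / 3 - z)) (fun w => sin (y - pi / 3 - w)) (s1 ++ s2).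
transitivity (sin (pi / 3) * ice_sum xs (s1 ++ s2) *
   (e (fun z => wt_a (z - y)) (fun w => sin (y + pi / 3 - w)) xs *
    e (fun z => wt_a (y + pi / 3 - z)) (fun w => sin (y + pi / 3 - w)) (s1 ++ s2) -
    e (fun z => wt_b (z - y)) (fun w => sin (y - pi / 3 - w)) xs *
    e (fun z => wt_b (y - pi / 3 - z)) (fun w => sin (y - pi / 3 - w)) (s1 ++ s2))).
  by rewrite /e; ring.
rewrite hx => [|z]; last first.
  rewrite /wt_a /wt_b (_ : y + pi / 3 - z = pi / 3 - (z - y)); last by ring.
  by rewrite (_ : y - pi / 3 - z = - (pi / 3 + (z - y))) ?sinN; ring.
rewrite hs => [|z]; last first.
  rewrite /wt_a /wt_b (_ : pi / 3 + (y + pi / 3 - z) = y - pi / 3 - z + pi); last by field.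
  rewrite (_ : pi / 3 - (y - pi / 3 - z) = - (y + pi / 3 - z) + pi); last by field.
  by rewrite !sinDpi sinN; ring.
(* The numbers of sign changes from rows and from columns are equal, so they cancel. *)
by rewrite mulrACA sx size_cat -expr2 sqrr_sign mul1r subrr mulr0.
Qed.

Lemma trig_poly_ice_numerator (R : realType) (xs ys : seq R) :
  trig_poly (size ys - 1 + size (xs ++ ys)) (ice_numerator xs ys).
Proof.
apply: trig_poly_mul; first exact: (trig_poly_ice_sum [::]).
by apply: trig_poly_prod => w; exact: trig_poly_sinB.
Qed.

Definition three_sum (R : realType) (f : R -> R) (t : R) : R :=
  f t + f (t + 2 * pi / 3) + f (t + 4 * pi / 3).

Lemma trig_poly_three_sum (R : realType) d (f : R -> R) :
  trig_poly d f -> trig_poly d (three_sum f).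
Proof.
move=> Tf; apply: trig_poly_add; first apply: trig_poly_add => //.
  exact: trig_poly_shift.
exact: trig_poly_shift.
Qed.

Lemma trig_poly_D2pi (R : realType) d (f : R -> R) t :
  trig_poly d f -> f (t + 2 * pi) = f t.
Proof.
move=> Tf; rewrite mulr_natl mulr2n addrA !(trig_polyDpi _ Tf) mulrA -expr2.
by rewrite sqrr_sign mul1r.
Qed.

(** Modulo [pi], a shift by [2 pi / 3] permutes the points [y], [y + pi / 3] and [y - pi / 3]. *)
Lemma three_sum_zero (R : realType) d (f : R -> R) y : trig_poly d f ->
  f y = 0 -> f (y + pi / 3) + f (y - pi / 3) = 0 ->
  [/\ three_sum f y = 0, three_sum f (y + pi / 3) = 0 &
      three_sum f (y - pi / 3) = 0].
Proof.
move=> Tf y0 ypm; rewrite /three_sum.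
have e1 : y + 2 * pi / 3 = y - pi / 3 + pi by field.
have e2 : y + 4 * pi / 3 = y + pi / 3 + pi by field.
have e3 : y + pi / 3 + 2 * pi / 3 = y + pi by field.
have e4 : y + pi / 3 + 4 * pi / 3 = y - pi / 3 + 2 * pi by field.
have e5 : y - pi / 3 + 2 * pi / 3 = y + pi / 3 by field.
have e6 : y - pi / 3 + 4 * pi / 3 = y + pi by field.
rewrite e3 e4 e5 e6 e1 e2 !(trig_polyDpi _ Tf) (trig_poly_D2pi _ Tf) y0 mulr0 addr0 add0r.
split=> //; last by rewrite addr0 addrC.
by rewrite -mulrDr [f (y - _) + _]addrC ypm mulr0.
Qed.

Definition third_points (R : realType) (y : R) : seq R :=
  [:: y; y + pi / 3; y - pi / 3].

Definition third_apart (R : realType) (z y : R) : bool :=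
  all (fun c => sin (y - c) != 0) (third_points z).

Lemma sin_neq0_pi_third (R : realType) : sin (pi / 3 : R) != 0.
Proof. by rewrite sin_pi_third mulf_neq0 ?invr_eq0// gt_eqF// sqrt3_gt0. Qed.

Lemma third_apart_sin (R : realType) (z y c d : R) : third_apart z y ->
  c \in third_points z -> d \in third_points y -> sin (c - d) != 0.
Proof.
rewrite /third_apart /= andbT => /and3P[h0 hp hm].
have key (u v : R) : sin v != 0 -> (u = - v \/ u = - v + pi \/ u = - v - pi) -> sin u != 0.
  move=> sv [->|[->|->]]; first by rewrite sinN oppr_eq0.
    by rewrite sinDpi sinN opprK.
  by rewrite -[- v - pi]opprD sinN sinDpi opprK.
rewrite !inE => /or3P[] /eqP -> /or3P[] /eqP ->.
- by apply: (key _ _ h0); left; ring.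
- by apply: (key _ _ hm); left; field.
- by apply: (key _ _ hp); left; field.
- by apply: (key _ _ hp); left; field.
- by apply: (key _ _ h0); left; field.
- by apply: (key _ _ hm); right; left; field.
- by apply: (key _ _ hm); left; field.
- by apply: (key _ _ hp); right; right; field.
- by apply: (key _ _ h0); left; field.
Qed.

Lemma size_flatten_third_points (R : realType) (ys : seq R) :
  size (flatten [seq third_points y | y <- ys]) = (3 * size ys)%N.
Proof. by elim: ys => [//|y ys IH]; rewrite /= IH mulnS. Qed.

Lemma pairwise_third_points (R : realType) (ys : seq R) :
  pairwise (@third_apart R) ys ->
  pairwise (fun x y => sin (x - y) != 0) (flatten [seq third_points y | y <- ys]).
Proof.
elim: ys => [//|y ys IH] /andP[ay /IH {}IH].
rewrite [flatten _]/= -[[:: _, _, _ & _]]/(third_points y ++ _) pairwise_cat IH andbT.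
apply/andP; split.
  apply/allrelP => c d cy /flatten_mapP[z zys dz].
  by apply: third_apart_sin cy dz; exact: (allP ay).
have s3 := sin_neq0_pi_third R.
rewrite /= !andbT (_ : y - (y + pi / 3) = - (pi / 3)); last by ring.
rewrite (_ : y - (y - pi / 3) = pi / 3); last by ring.
rewrite (_ : y + pi / 3 - (y - pi / 3) = - (pi / 3) + pi); last by field.
by rewrite sinDpi sinN opprK oppr_eq0 s3.
Qed.

Lemma trig_poly_cancel_prod (R : realType) d (g : R -> R) (s : seq R) :
  trig_poly d g -> (forall t, \prod_(c <- s) sin (t - c) * g t = 0) ->
  forall t, g t = 0.
Proof.
move=> Tg; elim: s => [|c s IH] h; first by move=> t; rewrite -(h t) big_nil mul1r.
apply: IH; have Ts := trig_poly_mul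
  (trig_poly_prod s (F := fun c t => sin (t - c)) (@trig_poly_sinB R)) Tg.
by apply: (trig_poly_cancel (c := c) Ts) => t; rewrite mulrA; have := h t; rewrite big_cons.
Qed.

(** The entries become arbitrary one at a time: a trigonometric polynomial in one entry that
    vanishes outside finitely many points modulo [pi] is zero. *)
Lemma generic_extend (R : realType) (P : seq R -> R) n d :
  (forall s1 s2, (size s1 + size s2).+1 = n -> trig_poly d (fun t => P (s1 ++ t :: s2))) ->
  (forall ys, size ys = n -> pairwise (@third_apart R) ys -> P ys = 0) ->
  forall ys, size ys = n -> P ys = 0.
Proof.
move=> TP P0.
(* [s1] is the part still generic and [s2] the part already arbitrary. *)
suff H s2 : forall s1, (size s1 + size s2)%N = n -> pairwise (@third_apart R) s1 ->
    P (s1 ++ s2) = 0 by move=> ys sy; exact: (H ys [::]).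
elim: s2 => [|y s2 IH] s1 sn ps1; first by rewrite cats0 P0 // -sn addn0.
have Tg : trig_poly d (fun t => P (s1 ++ t :: s2)).
  by apply: TP; rewrite -sn /= addnS.
apply: (trig_poly_cancel_prod (s := flatten [seq third_points z | z <- s1]) Tg) => t.
have [tz|/allPn[c cs /negPn/eqP sc]] :=
  boolP (all (fun c => sin (t - c) != 0) (flatten [seq third_points z | z <- s1])).
- rewrite -cat_rcons IH ?mulr0 ?size_rcons ?addSnnS// -cats1 pairwise_cat ps1 /= andbT.
  apply/allrelP => z w zs; rewrite inE => /eqP ->.
  by apply/allP => c cz; apply: (allP tz); apply/flatten_mapP; exists z.
- by rewrite (big_rem c cs) /= sc !mul0r.
Qed.

(** For generic [ys] there are [3 * size ys] distinct zeros modulo [pi], against the degree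
    [3 * size ys - 2]; the dependence on each [y] is again a trigonometric polynomial. *)
Lemma three_sum_ice_numerator (R : realType) (xs ys : seq R) t :
  (size xs).+1 = size ys -> three_sum (ice_numerator xs ys) t = 0.
Proof.
move=> sy.
apply: (generic_extend (P := fun ys => three_sum (ice_numerator xs ys) t)
  (d := (size xs).+1) _ _ (esym sy)) => {ys sy}.
  move=> s1 s2 [sx].
  have Tn u : trig_poly (size xs).+1 (fun y => ice_numerator xs (s1 ++ y :: s2) u).
    have := trig_poly_mul (@trig_poly_ice_sum_col _ s1 s2 (u :: xs) (congr1 S (esym sx)))
      (trig_poly_scale (\prod_(w <- xs ++ s1 ++ s2) sin (u - w)) (trig_poly_sinBl u)).
    rewrite /= subn1 addn1; apply: trig_poly_ext => y.
    by rewrite /ice_numerator !big_cat big_cons /=; ring.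
  by apply: trig_poly_add; [apply: trig_poly_add|].
move=> ys sy py; have TN := trig_poly_ice_numerator xs ys.
apply: (trig_poly_eq0 (trig_poly_three_sum TN) _ (pairwise_third_points py)).
  by rewrite size_flatten_third_points size_cat sy; lia.
move=> c /flatten_mapP[y yys].
case/splitPr: yys sy {py TN} => s1 s2 sy.
have sx : size xs = (size s1 + size s2)%N by move: sy; rewrite size_cat /= addnS => -[].
have [] := three_sum_zero (trig_poly_ice_numerator xs (s1 ++ y :: s2)) _
  (ice_numerator_pm y sx).
  by rewrite /ice_numerator !big_cat big_cons /= subrr sin0 !(mul0r, mulr0).
by move=> h1 h2 h3; rewrite !inE => /or3P[] /eqP ->.
Qed.

Definition Zn_numerator (R : realType) n (v1 v2 : seq R) (t : R) : R :=
  Zn n (v1 ++ t :: v2) * \prod_(w <- v1 ++ v2) sin (t - w).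

Lemma Zn_numeratorP (R : realType) n (v1 v2 : seq R) : (0 < n)%N ->
  (size v1 + size v2).+1 = (2 * n)%N ->
  [/\ trig_poly (n - 1) (fun t => Zn n (v1 ++ t :: v2)),
      trig_poly (3 * n - 2) (Zn_numerator n v1 v2) &
      forall t, three_sum (Zn_numerator n v1 v2) t = 0].
Proof.
move=> n0 sv.
suff [TZ h] : trig_poly (n - 1) (fun t => Zn n (v1 ++ t :: v2)) /\
    forall t, three_sum (Zn_numerator n v1 v2) t = 0.
  split=> //; rewrite (_ : 3 * n - 2 = n - 1 + size (v1 ++ v2))%N.
    by apply: trig_poly_mul TZ _; apply: trig_poly_prod => w; exact: trig_poly_sinB.
  by rewrite size_cat; lia.
have [lt|ge] := ltnP (size v1) n.
- pose a := take (n - (size v1).+1) v2; pose b := drop (n - (size v1).+1) v2.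
  have sa : size a = (n - (size v1).+1)%N by rewrite size_takel//; lia.
  have sb : size b = n by rewrite size_drop; lia.
  have Zt t : Zn n (v1 ++ t :: v2) = ice_sum (t :: v1 ++ a) b.
    rewrite -ice_sum_front -(@Zn_cat _ n)//; last by rewrite size_cat /= sa; lia.
    by rewrite -catA /= cat_take_drop.
  split.
    have := trig_poly_ice_sum [::] (v1 ++ a) b.
    by rewrite sb; apply: trig_poly_ext => t; rewrite Zt.
  move=> t; rewrite -(@three_sum_ice_numerator _ (v1 ++ a) b t).
    have e u : Zn_numerator n v1 v2 u = ice_numerator (v1 ++ a) b u.
      by rewrite /Zn_numerator /ice_numerator Zt -catA cat_take_drop.
    by rewrite /three_sum !e.
  by rewrite size_cat sa sb; lia.
(* Here [t] is a column parameter; transposition makes [- t] a row parameter. *)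
pose a := take n v1; pose b := drop n v1.
have sa : size a = n by rewrite size_takel.
have sb : size b = (size v1 - n)%N by rewrite size_drop.
have Zt t : Zn n (v1 ++ t :: v2) =
    ice_sum (- t :: [seq - y | y <- b ++ v2]) [seq - x | x <- a].
  rewrite -map_cons -ice_sumT; last by rewrite /= size_cat sa sb; lia.
  rewrite -ice_sum_front_col; last by rewrite size_cat /= sa sb; lia.
  rewrite -(@Zn_cat _ n)//; last by rewrite size_cat /= sb; lia.
  by rewrite catA cat_take_drop.
split.
  have := trig_poly_opp (trig_poly_ice_sum [::] [seq - y | y <- b ++ v2] [seq - x | x <- a]).
  by rewrite size_map sa; apply: trig_poly_ext => t; rewrite Zt.
have sz2 : (size b + size v2).+1 = n by rewrite sb; lia.
have prodN (s : seq R) u : \prod_(w <- [seq - y | y <- s]) sin (- u - w) =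
    (-1) ^+ size s * \prod_(w <- s) sin (u - w).
  elim: s => [|w s IH]; first by rewrite !big_nil mulr1.
  by rewrite !big_cons IH (_ : - u - - w = - (u - w)) ?sinN /= ?exprS; ring.
have e u : Zn_numerator n v1 v2 u = (-1) ^+ size (v1 ++ v2) *
    ice_numerator [seq - y | y <- b ++ v2] [seq - x | x <- a] (- u).
  have pv : perm_eq ((b ++ v2) ++ a) (v1 ++ v2).
    by rewrite perm_catC catA cat_take_drop.
  rewrite /Zn_numerator /ice_numerator Zt -map_cat prodN (perm_big _ pv) (perm_size pv).
  by rewrite mulrCA [X in _ = _ * X]mulrA -expr2 sqrr_sign mul1r.
(* From this starting point the three arguments are the negatives of [t + 4 pi / 3], [t + 2 pi / 3]
   and [t]. *)
move=> t; have := @three_sum_ice_numerator _ [seq - y | y <- b ++ v2] [seq - x | x <- a]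
  (- t - 4 * pi / 3).
rewrite /three_sum !e -!mulrDr => h.
rewrite [X in _ * X](_ : _ = 0) ?mulr0// -h; last first.
  by rewrite !size_map size_cat sa; exact: sz2.
rewrite [RHS]addrC [X in _ = _ + X]addrC addrA; congr (_ + _ + _); congr ice_numerator; by field.
Qed.

(** * Spaces of given frequencies and their jets at 0 *)

Inductive trig_span (R : realType) (K : R -> Prop) : (R -> R) -> Prop :=
| trig_span_zero : trig_span K (fun=> 0)
| trig_span_cos k : K k -> trig_span K (fun t => cos (k * t))
| trig_span_sin k : K k -> trig_span K (fun t => sin (k * t))
| trig_span_comb c g h : trig_span K g -> trig_span K h ->
    trig_span K (fun t => c * g t + h t)
| trig_span_ext g h : (forall t, g t = h t) -> trig_span K h -> trig_span K g.

Lemma trig_span_scale (R : realType) (K : R -> Prop) c g :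
  trig_span K g -> trig_span K (fun t => c * g t).
Proof.
move=> /(trig_span_comb c)/(_ (trig_span_zero K)).
by apply: trig_span_ext => t; rewrite addr0.
Qed.

Lemma trig_span_add (R : realType) (K : R -> Prop) g h :
  trig_span K g -> trig_span K h -> trig_span K (fun t => g t + h t).
Proof.
move=> Sg /(trig_span_comb 1 Sg).
by apply: trig_span_ext => t; rewrite mul1r.
Qed.

Lemma trig_span_sum (R : realType) (K : R -> Prop) (I : finType) (F : I -> R -> R) :
  (forall i, trig_span K (F i)) -> trig_span K (fun t => \sum_i F i t).
Proof.
move=> SF; elim: (index_enum I) => [|i s IH].
  by apply: trig_span_ext (trig_span_zero K) => t; rewrite big_nil.
by apply: trig_span_ext (trig_span_add (SF i) IH) => t; rewrite big_cons.
Qed.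

Lemma trig_span_mul (R : realType) (K K' : R -> Prop) g :
  (forall k, K k -> K' (k + 1) /\ K' (k - 1)) -> trig_span K g ->
  trig_span K' (fun t => cos t * g t) /\ trig_span K' (fun t => sin t * g t).
Proof.
move=> KK'; have half : 2^-1 * 2 = 1 :> R by rewrite mulVf.
elim=> {g} [|k /KK'[kp km]|k /KK'[kp km]|c g h _ [IH1 IH2] _ [IH3 IH4]|g h gh _ [IH1 IH2]].
- by split; apply: trig_span_ext (trig_span_zero _) => t; rewrite mulr0.
- split.
    apply: trig_span_ext (trig_span_comb 2^-1 (trig_span_cos kp)
      (trig_span_scale 2^-1 (trig_span_cos km))) => t.
    by rewrite mulrDl mulrBl mul1r cosD cosB; field.
  apply: trig_span_ext (trig_span_comb 2^-1 (trig_span_sin kp)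
    (trig_span_scale (- 2^-1) (trig_span_sin km))) => t.
  by rewrite mulrDl mulrBl mul1r sinD sinB; field.
- split.
    apply: trig_span_ext (trig_span_comb 2^-1 (trig_span_sin kp)
      (trig_span_scale 2^-1 (trig_span_sin km))) => t.
    by rewrite mulrDl mulrBl mul1r sinD sinB; field.
  apply: trig_span_ext (trig_span_comb (- 2^-1) (trig_span_cos kp)
    (trig_span_scale 2^-1 (trig_span_cos km))) => t.
  by rewrite mulrDl mulrBl mul1r cosD cosB; field.
- split.
    by apply: trig_span_ext (trig_span_comb c IH1 IH3) => t; ring.
  by apply: trig_span_ext (trig_span_comb c IH2 IH4) => t; ring.
- by split; [apply: trig_span_ext IH1|apply: trig_span_ext IH2] => t; rewrite gh.
Qed.

Definition trig_freq (R : realType) (d : nat) (k : R) : Prop :=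
  exists2 m, (m <= d)%N & k = (2 * m)%:R - d%:R.

Lemma trig_poly_span (R : realType) d (g : R -> R) : trig_poly d g ->
  trig_span (@trig_freq R d) g.
Proof.
elim: d g => [|d IH] g.
  move=> [c gc]; have K0 : trig_freq 0 (0 : R).
    by exists 0%N; rewrite ?subrr.
  apply: trig_span_ext (trig_span_scale c (trig_span_cos K0)) => t.
  by rewrite gc mul0r cos0 mulr1.
move=> [g1 [g2 [/IH S1 /IH S2 eg]]].
have KK (k : R) : trig_freq d k -> trig_freq d.+1 (k + 1) /\ trig_freq d.+1 (k - 1).
  move=> [m md ->]; split.
    by exists m.+1 => //; rewrite mulnS natrD -natr1; ring.
  by exists m; [exact: leqW|rewrite -natr1; ring].
have [Sc _] := trig_span_mul KK S1; have [_ Ss] := trig_span_mul KK S2.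
by apply: trig_span_ext (trig_span_add Sc Ss).
Qed.

Lemma trig_span_derive (R : realType) (K : R -> Prop) (g : R -> R) : trig_span K g ->
  exists2 g' : R -> R, trig_span K g' & forall t : R, is_derive t (1 : R) g (g' t).
Proof.
have lin (k t : R) : is_derive t (1 : R) (fun t => k * t) k.
  by apply: is_derive_eq; rewrite /GRing.scale /= mulr1.
elim=> {g} [|k Kk|k Kk|c g h _ [g' Sg' dg] _ [h' Sh' dh]|g h gh _ [h' Sh' dh]].
- by exists (fun=> 0) => [|t]; [exact: trig_span_zero|exact: is_derive_cst].
- exists (fun t => - k * sin (k * t)); first exact/trig_span_scale/trig_span_sin.
  move=> t; have := is_derive1_comp (is_derive_cos (k * t)) (lin k t).
  by move=> /is_derive_eq; apply; ring.
- exists (fun t => k * cos (k * t)); first exact/trig_span_scale/trig_span_cos.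
  move=> t; have := is_derive1_comp (is_derive_sin (k * t)) (lin k t).
  by move=> /is_derive_eq; apply; ring.
- exists (fun t => c * g' t + h' t); first exact: trig_span_comb.
  by move=> t; exact: is_deriveD (is_deriveZ c (dg t)) (dh t).
- by exists h' => // t; rewrite (_ : g = h) //; apply/funext.
Qed.

Lemma trig_span_derive1 (R : realType) (K : R -> Prop) (g : R -> R) :
  trig_span K g -> trig_span K (derive1 g).
Proof.
move=> /trig_span_derive[g' Sg' dg]; apply: trig_span_ext Sg' => t.
by rewrite derive1E; apply: derive_val.
Qed.

Lemma trig_span_derive1n (R : realType) (K : R -> Prop) m (g : R -> R) :
  trig_span K g -> trig_span K (derive1n m g).
Proof. by move=> Sg; elim: m => [//|m IH]; exact: trig_span_derive1. Qed.

Lemma derive1n_comb (R : realType) (K : R -> Prop) m c (g h : R -> R) :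
  trig_span K g -> trig_span K h ->
  derive1n m (fun t => c * g t + h t) =
  fun t => c * derive1n m g t + derive1n m h t.
Proof.
elim: m g h => [//|m IH] g h Sg Sh; rewrite /derive1n !iterSr.
have -> : derive1 (fun t => c * g t + h t) = fun t => c * derive1 g t + derive1 h t.
  have [g' _ dg] := trig_span_derive Sg; have [h' _ dh] := trig_span_derive Sh.
  apply/funext => t; rewrite !derive1E.
  have dgh := is_deriveD (is_deriveZ c (dg t)) (dh t).
  by rewrite [LHS](@derive_val _ _ _ _ _ _ _ dgh) (@derive_val _ _ _ _ _ _ _ (dg t))
    (@derive_val _ _ _ _ _ _ _ (dh t)).
exact: (IH _ _ (trig_span_derive1 Sg) (trig_span_derive1 Sh)).
Qed.

(* Among the frequencies [2 m - (3 n - 2)] with [m <= 3 n - 2], those divisible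
   by 3 have [m = 2 %[mod 3]], and the classes 0 and 1 of [m] are exchanged by
   [k |-> - k]; [ice_freq] lists the class 0. *)
Definition ice_freq (R : realType) (n m : nat) : R := (6 * m)%:R - (3 * n)%:R + 2.

Definition is_ice_freq (R : realType) (n : nat) (k : R) : Prop :=
  exists2 m, (m < n)%N & k = ice_freq R n m.

Lemma periodicity_nat (R : realType) (f : R -> R) (a b : nat) x :
  (forall x, f (x + pi) = - f x) -> f (x + 2 * pi * a%:R - 2 * pi * b%:R) = f x.
Proof.
move=> fpi; have f2 y : f (y + 2 * pi) = f y.
  by rewrite mulr_natl mulr2n addrA !fpi opprK.
have fN (c : nat) y : f (y + 2 * pi * c%:R) = f y.
  elim: c y => [|c IH] y; first by rewrite mulr0 addr0.
  by rewrite -[c.+1%:R]natr1 mulrDr mulr1 addrA f2 IH.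
by rewrite -(fN b) subrK fN.
Qed.

(** [k] is congruent to [2 (m + 1)] modulo 3, and the three phases cancel unless 3 divides [k]. The
    two hypotheses on [f] treat sine and cosine together. *)
Lemma three_sum_wave (R : realType) (f : R -> R) n m t : (0 < n)%N ->
  (forall x, f (x + pi) = - f x) ->
  (forall x, f (x + pi / 3) + f (x - pi / 3) = f x) ->
  let k : R := (2 * m)%:R - (3 * n - 2)%:R in
  three_sum (fun t => f (k * t)) t = if (m %% 3 == 2)%N then 3 * f (k * t) else 0.
Proof.
move=> n0 fpi f3 k.
set q := (m %/ 3)%N; set r := (m %% 3)%N.
have kE : k = 6 * q%:R + 2 * r%:R - 3 * n%:R + 2.
  rewrite /k natrB; last by lia.
  by rewrite {1}(divn_eq m 3) -/q -/r !natrM natrD natrM; ring.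
have e1 : k * (t + 2 * pi / 3) =
    k * t + (r%:R + 1) * 4 * pi / 3 + 2 * pi * (2 * q)%:R - 2 * pi * n%:R.
  by rewrite mulrDr kE natrM; field.
have e2 : k * (t + 4 * pi / 3) =
    k * t + (r%:R + 1) * 8 * pi / 3 + 2 * pi * (4 * q)%:R - 2 * pi * (2 * n)%:R.
  by rewrite mulrDr kE !natrM; field.
rewrite /three_sum e1 e2 !periodicity_nat//; move: (k * t) => x.
have : (r < 3)%N by rewrite ltn_mod.
have per (a : nat) y z : z = y + 2 * pi * a%:R - 2 * pi * 0%:R -> f z = f y.
  by move=> ->; rewrite periodicity_nat.
case: r {e1 e2 kE} => [|[|[|//]]] _ /=.
- rewrite [f (_ + _ * 4 * _ / _)](per 0%N (x + pi / 3 + pi)); last by field.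
  rewrite [f (_ + _ * 8 * _ / _)](per 1%N (x - pi / 3 + pi)); last by field.
  by rewrite !fpi -addrA -opprD f3 subrr.
- rewrite [f (_ + _ * 4 * _ / _)](per 1%N (x - pi / 3 + pi)); last by field.
  rewrite [f (_ + _ * 8 * _ / _)](per 2%N (x + pi / 3 + pi)); last by field.
  by rewrite !fpi -addrA -opprD [f (x - _) + _]addrC f3 subrr.
- rewrite [f (_ + _ * 4 * _ / _)](per 2%N x); last by field.
  by rewrite [f (_ + _ * 8 * _ / _)](per 4%N x); [ring|field].
Qed.

Lemma trig_span_ice (R : realType) n (g : R -> R) : (0 < n)%N ->
  trig_poly (3 * n - 2) g -> (forall t, three_sum g t = 0) ->
  trig_span (@is_ice_freq R n) g.
Proof.
move=> n0 /trig_poly_span Sg g3.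
(* Subtracting this average is a projection that fixes [g] and can be computed wave by wave. *)
suff : trig_span (@is_ice_freq R n) (fun t => g t - 3^-1 * three_sum g t).
  by apply: trig_span_ext => t; rewrite g3 mulr0 subr0.
have c3 (x : R) : cos (x + pi / 3) + cos (x - pi / 3) = cos x.
  by rewrite cosD cosB cos_pi_third; field.
have s3 (x : R) : sin (x + pi / 3) + sin (x - pi / 3) = sin x.
  by rewrite sinD sinB cos_pi_third; field.
have freq m : (m <= 3 * n - 2)%N -> (m %% 3 == 2)%N = false ->
    let k : R := (2 * m)%:R - (3 * n - 2)%:R in
    is_ice_freq n k \/ is_ice_freq n (- k).
  move=> mn m2 k; have r3 : (m %% 3 < 3)%N by rewrite ltn_mod.
  have kE : k = 2 * m%:R - 3 * n%:R + 2.
    by rewrite /k natrB ?natrM; [ring|lia].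
  case e: (m %% 3)%N r3 m2 => [|[|[|//]]] _ // _.
    left; exists (m %/ 3)%N; first by lia.
    rewrite kE /ice_freq {1}(divn_eq m 3) e !natrM natrD natrM; ring.
  (* For [m = 3 q + 1], the frequency [- k] is [ice_freq R n (n - 1 - q)]. *)
  right; exists (n - 1 - m %/ 3)%N; first by lia.
  rewrite kE /ice_freq {1}(divn_eq m 3) e natrM natrD !natrM -subnDA natrB; last by lia.
  rewrite natrD; ring.
elim: Sg {g3} => {g} [|k [m mn ->]|k [m mn ->]|c g h _ IHg _ IHh|g h gh _ IH].
- by apply: trig_span_ext (trig_span_zero _) => t; rewrite /three_sum !addr0 mulr0 subr0.
- have T3 t := three_sum_wave m t n0 (@cosDpi R) c3.
  case m2 : (m %% 3 == 2)%N T3 => T3.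
    by apply: trig_span_ext (trig_span_zero _) => t; rewrite T3 mulrA mulVf// mul1r subrr.
  have [fk|fk] := freq m mn m2.
    by apply: trig_span_ext (trig_span_cos fk) => t; rewrite T3 mulr0 subr0.
  by apply: trig_span_ext (trig_span_cos fk) => t; rewrite T3 mulr0 subr0 mulNr cosN.
- have T3 t := three_sum_wave m t n0 (@sinDpi R) s3.
  case m2 : (m %% 3 == 2)%N T3 => T3.
    by apply: trig_span_ext (trig_span_zero _) => t; rewrite T3 mulrA mulVf// mul1r subrr.
  have [fk|fk] := freq m mn m2.
    by apply: trig_span_ext (trig_span_sin fk) => t; rewrite T3 mulr0 subr0.
  apply: trig_span_ext (trig_span_scale (-1) (trig_span_sin fk)) => t.
  by rewrite T3 mulr0 subr0 [_ * t in RHS]mulNr sinN mulN1r opprK.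
- apply: trig_span_ext (trig_span_comb c IHg IHh) => t.
  by rewrite /three_sum; ring.
- by apply: trig_span_ext IH => t; rewrite /three_sum !gh.
Qed.

Definition ice_wave (R : realType) n (al be : 'I_n -> R) (t : R) : R :=
  \sum_(m < n) (al m * cos (ice_freq R n m * t) + be m * sin (ice_freq R n m * t)).

Lemma trig_span_ice_wave (R : realType) n (g : R -> R) :
  trig_span (@is_ice_freq R n) g ->
  exists al be : 'I_n -> R, forall t, g t = ice_wave al be t.
Proof.
elim=> {g} [|k [m mn ->]|k [m mn ->]|c g h _ [a [b gE]] _ [a' [b' hE]]|g h gh _ [a [b hE]]].
- exists (fun=> 0), (fun=> 0) => t; rewrite /ice_wave big1// => m _.
  by rewrite !mul0r addr0.
- exists (fun l => (l == Ordinal mn)%:R), (fun=> 0) => t.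
  rewrite /ice_wave (bigD1 (Ordinal mn))//= eqxx mul1r mul0r addr0.
  by rewrite big1 ?addr0// => l /negbTE ->; rewrite !mul0r addr0.
- exists (fun=> 0), (fun l => (l == Ordinal mn)%:R) => t.
  rewrite /ice_wave (bigD1 (Ordinal mn))//= eqxx mul1r mul0r add0r.
  by rewrite big1 ?addr0// => l /negbTE ->; rewrite !mul0r addr0.
- exists (fun l => c * a l + a' l), (fun l => c * b l + b' l) => t.
  rewrite gE hE /ice_wave mulr_sumr -big_split; apply: eq_bigr => l _ /=.
  by ring.
- by exists a, b => t; rewrite gh.
Qed.

Lemma derive1_ice_wave (R : realType) n (al be : 'I_n -> R) :
  derive1 (ice_wave al be) =
  ice_wave (fun m => ice_freq R n m * be m) (fun m => - (ice_freq R n m * al m)).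
Proof.
apply/funext => t; rewrite derive1E.
pose h (m : 'I_n) u := al m * cos (ice_freq R n m * u) + be m * sin (ice_freq R n m * u).
have -> : ice_wave al be = \sum_(m < n) h m by apply/funext => u; rewrite fct_sumE.
apply: derive_val.
apply: is_derive_sum => m.
have lin (k : R) : is_derive t (1 : R) (fun t => k * t) k.
  by apply: is_derive_eq; rewrite /GRing.scale /= mulr1.
have dc := is_derive1_comp (is_derive_cos (ice_freq R n m * t)) (lin (ice_freq R n m)).
have ds := is_derive1_comp (is_derive_sin (ice_freq R n m * t)) (lin (ice_freq R n m)).
have := is_deriveD (is_deriveZ (al m) dc) (is_deriveZ (be m) ds).
by move=> /is_derive_eq; apply; rewrite /GRing.scale /=; ring.
Qed.

Lemma derive1n_double_ice_wave (R : realType) n l (al be : 'I_n -> R) :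
  derive1n l.*2 (ice_wave al be) =
  ice_wave (fun m => al m * (- ice_freq R n m ^+ 2) ^+ l)
           (fun m => be m * (- ice_freq R n m ^+ 2) ^+ l).
Proof.
elim: l al be => [|l IH] al be.
  apply/funext => t; apply: eq_bigr => m _.
  by rewrite !expr0 !mulr1.
rewrite doubleS /derive1n !iterSr !derive1_ice_wave -/(derive1n _ _) IH.
by apply/funext => t; apply: eq_bigr => m _; rewrite !exprS; ring.
Qed.

Lemma ice_freq_inj (R : realType) n :
  injective (fun m : 'I_n => - ice_freq R n m ^+ 2).
Proof.
move=> m l /oppr_inj /eqP; rewrite eqf_sqr => /orP[|] /eqP; rewrite /ice_freq.
  by move=> /addIr /addIr /eqP; rewrite eqr_nat => /eqP ml; apply: val_inj => /=; lia.
(* Opposite frequencies would give an equality that fails modulo 6. *)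
move=> e; have /eqP : (6 * m + 6 * l + 4)%:R = (6 * n)%:R :> R.
  rewrite !natrD; move: e; rewrite !natrM => e; lra.
by rewrite eqr_nat => /eqP; lia.
Qed.

Lemma power_sums_eq0 (R : fieldType) n (x c : 'I_n -> R) : injective x ->
  (forall l, (l < n)%N -> \sum_(m < n) c m * x m ^+ l = 0) -> forall m, c m = 0.
Proof.
move=> xi c0 m.
have V : Vandermonde n (\row_j x j) \in unitmx.
  rewrite unitmxE det_Vandermonde unitfE; apply/prodf_neq0 => i _.
  apply/prodf_neq0 => j ij; rewrite !mxE subr_eq0 (inj_eq xi).
  by rewrite neq_ltn ij orbT.
have : Vandermonde n (\row_j x j) *m (\col_j c j) = 0.
  apply/matrixP => i j; rewrite !mxE -[RHS](c0 i)//.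
  by apply: eq_bigr => k _; rewrite !mxE mulrC.
move=> /(congr1 (mulmx (invmx (Vandermonde n (\row_j x j))))).
by rewrite mulKmx// mulmx0 => /matrixP/(_ m 0); rewrite !mxE.
Qed.

(** At 0, even derivatives see only the cosine coefficients and odd ones only the sine coefficients;
    each half is a Vandermonde system in the distinct numbers [- k ^ 2]. *)
Lemma ice_jet_eq0 (R : realType) n (g : R -> R) :
  trig_span (@is_ice_freq R n) g ->
  (forall m, (m < 2 * n)%N -> derive1n m g 0 = 0) -> forall t, g t = 0.
Proof.
move=> /trig_span_ice_wave[al [be gE]] g0.
have {}gE : g = ice_wave al be by apply/funext.
have wave0 (a b : 'I_n -> R) : ice_wave a b 0 = \sum_m a m.
  by apply: eq_bigr => m _; rewrite mulr0 cos0 sin0 mulr0 addr0 mulr1.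
have al0 : forall m, al m = 0.
  apply: (power_sums_eq0 (@ice_freq_inj R n)) => l ln.
  have := g0 l.*2; rewrite gE derive1n_double_ice_wave wave0.
  by apply; rewrite -mul2n ltn_mul2l.
have be0 : forall m : 'I_n, ice_freq R n m * be m = 0.
  apply: (power_sums_eq0 (@ice_freq_inj R n)) => l ln.
  have := g0 l.*2.+1; rewrite gE /derive1n iterSr derive1_ice_wave.
  rewrite -/(derive1n _ _) derive1n_double_ice_wave wave0.
  by apply; rewrite -mul2n; lia.
move=> t; rewrite gE /ice_wave big1// => m _.
have /eqP := be0 m; rewrite al0 mul0r add0r mulf_eq0 => /orP[/eqP k0|/eqP ->].
  by rewrite k0 mul0r sin0 mulr0.
by rewrite mul0r.
Qed.

(** The derivative of order [k] of [f] vanishes at 0 to order exactly [2 n - 1 - k], so a multiple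
    of it removes the leading term of [g], and the induction ends with a zero jet. *)
Lemma ice_derivative_basis (R : realType) n (f : R -> R) k (g : R -> R) :
  trig_span (@is_ice_freq R n) f ->
  (forall m, (m < 2 * n - 1)%N -> derive1n m f 0 = 0) ->
  derive1n (2 * n - 1) f 0 != 0 -> (k <= 2 * n)%N ->
  trig_span (@is_ice_freq R n) g ->
  (forall m, (m < 2 * n - k)%N -> derive1n m g 0 = 0) ->
  exists c : 'I_k -> R, forall t, g t = \sum_(j < k) c j * derive1n j f t.
Proof.
move=> Sf f0 f1; elim: k g => [|k IH] g kn Sg g0.
  exists (fun=> 0) => t; rewrite big_ord0; apply: ice_jet_eq0 Sg _ t => m.
  by rewrite -[(2 * n)%N]subn0; exact: g0.
pose a := derive1n (2 * n - k.+1) g 0 / derive1n (2 * n - 1) f 0.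
pose g' t := - a * derive1n k f t + g t.
have Sfk := trig_span_derive1n k Sf.
have [||m mk|c gE] := IH g'; [exact: ltnW|exact: trig_span_comb| |].
  rewrite /g' (derive1n_comb _ _ Sfk Sg) /derive1n -iterD -!/(derive1n _ _).
  have [mk'|mk'] := ltnP m (2 * n - k.+1).
    by rewrite g0// f0 ?mulr0 ?addr0//; lia.
  have -> : m = (2 * n - k.+1)%N by lia.
  have -> : (2 * n - k.+1 + k = 2 * n - 1)%N by lia.
  by rewrite mulNr divfK// addNr.
exists (fun j => if unlift ord_max j is Some i then c i else a) => t.
rewrite big_ord_recr /= unlift_none.
under eq_bigr => i _.
  rewrite (_ : widen_ord _ i = lift ord_max i); last by apply: ord_inj; rewrite lift_max.
  rewrite liftK; over.
by rewrite -gE /g' mulNr; ring.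
Qed.

(** * Induction on the number of parameters *)

Lemma Zn_zeros (R : realType) n : (0 < n)%N ->
  Zn n (nseq (2 * n) 0) = #|ASM n|%:R :> R.
Proof.
move=> n0; rewrite /Zn /partition_function -[RHS]sumr_const.
apply: eq_bigr => M _; rewrite big1// => i _; rewrite big1// => j _.
have nth0 m k : (nseq m (0 : R))`_k = 0 by rewrite nth_nseq if_same.
rewrite /vertex_weight !nth0 subrr wt_aE wt_bE sin0 cos0 mulr0 subr0 addr0.
by rewrite !if_same.
Qed.

Lemma card_ASM_gt0 n : (0 < #|ASM n|)%N.
Proof.
(* The identity matrix. *)
pose M : 'M[asm_entry]_n := \matrix_(i, j) to_asm_entry ((i == j)%:Z).
have ME i j : map_mx val M i j = (i == j)%:Z.
  by rewrite !mxE to_asm_entryK//; case: (i == j).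
have line (i : 'I_n) : asm_line [seq (i == j)%:Z | j <- enum 'I_n].
  rewrite asm_line_ice_path; last by move=> z /mapP[j _ ->]; case: (i == j).
  apply/ice_pathP; rewrite size_map size_enum_ord; split=> [j jn|].
    rewrite add0r -(sum_ord_take _ (Ordinal jn)).
    have [ij|ij] := leqP i j.
      rewrite (bigD1 i)//= eqxx big1// => l /andP[_].
      by rewrite eq_sym => /negbTE ->.
    rewrite big1// => l lj; case: eqP => // il; move: lj ij; rewrite il /=.
    by move=> h1 h2; have := leq_ltn_trans h1 h2; rewrite ltnn.
  rewrite add0r big_map big_enum /= (bigD1 i)//= eqxx big1// => l.
  by rewrite eq_sym => /negbTE ->.
apply/card_gt0P; exists M; rewrite inE; apply/andP; split; apply/forallP => i.
  by rewrite (eq_map (ME i)) line.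
by rewrite (_ : map _ _ = [seq (i == j)%:Z | j <- enum 'I_n]) ?line//;
  apply: eq_map => j; rewrite ME eq_sym.
Qed.

(** Families instead of tuples, so that [u \o lift i] removes a parameter. *)
Definition sin_vdm (R : realType) k (u : 'I_k -> R) : R :=
  \prod_(i < k) \prod_(j < k | (i < j)%N) sin (u i - u j).

Lemma prod_sign_lt (R : pzRingType) k i : (i <= k)%N ->
  \prod_(l < k) (if (l < i)%N then -1 else 1) = (-1) ^+ i :> R.
Proof.
move=> ik; rewrite -big_mkcond /= -(big_ord_widen k (fun=> -1))//.
by rewrite prodr_const card_ord.
Qed.

Lemma ltn_lift n (h : 'I_n) i j : (lift h i < lift h j)%N = (i < j)%N.
Proof. by rewrite !ltnNge leq_bump2. Qed.

Lemma lift_ltn n (i : 'I_n.+1) (l : 'I_n) : (lift i l < i)%N = (l < i)%N.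
Proof. by rewrite /= /bump; case: (leqP i l) => h; apply/idP/idP; lia. Qed.

Lemma ltn_lift_self n (i : 'I_n.+1) (l : 'I_n) : (i < lift i l)%N = ~~ (l < i)%N.
Proof. by rewrite /= /bump -leqNgt; case: (leqP i l) => h; apply/idP/idP; lia. Qed.

(** The [i] factors in which [u i] is subtracted change sign when it is written first. *)
Lemma sin_vdm_lift (R : realType) k (u : 'I_k.+1 -> R) (i : 'I_k.+1) :
  sin_vdm u = (-1) ^+ i * (\prod_(l < k) sin (u i - u (lift i l))) *
    sin_vdm (u \o lift i).
Proof.
have ik : (i <= k)%N by rewrite -ltnS.
rewrite -(prod_sign_lt R ik) -big_split /= [LHS](bigD1_ord i)//=.
rewrite [X in X * _]big_mkcond (bigD1_ord i)//= ltnn mul1r.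
have e l : \prod_(j < k.+1 | (lift i l < j)%N) sin (u (lift i l) - u j) =
   (if (lift i l < i)%N then sin (u (lift i l) - u i) else 1) *
   \prod_(j < k | (l < j)%N) sin (u (lift i l) - u (lift i j)).
  rewrite big_mkcond (bigD1_ord i)//= -big_mkcond; congr (_ * _).
  by apply: eq_bigl => j; rewrite ltn_lift.
rewrite [X in _ * X](eq_bigr _ (fun l _ => e l)) big_split /= mulrA; congr (_ * _).
rewrite -big_split; apply: eq_bigr => l _ /=.
rewrite -/(lift i l) lift_ltn ltn_lift_self.
case: (l < i)%N => /=; last by rewrite mulr1 mul1r.
by rewrite mul1r -opprB sinN mulN1r.
Qed.

Lemma perm_enum_lift k (i : 'I_k.+1) :
  perm_eq (enum 'I_k.+1) (i :: [seq lift i l | l <- enum 'I_k]).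
Proof.
apply: uniq_perm; first exact: enum_uniq.
  rewrite /= map_inj_uniq ?enum_uniq ?andbT; last exact: lift_inj.
  by apply/negP => /mapP[l _ /eqP]; rewrite eq_liftF.
move=> j; rewrite mem_enum; apply/esym.
have [l ->|->] := unliftP i j; last by rewrite mem_head.
by rewrite in_cons map_f ?orbT// mem_enum.
Qed.

Lemma left_kernel (F : fieldType) m n (B : 'M[F]_(m, n)) : (n < m)%N ->
  exists la : 'rV[F]_m, la != 0 /\ la *m B = 0.
Proof.
move=> nm; have : kermx B != 0.
  by rewrite kermx_eq0 -row_leq_rank -ltnNge (leq_ltn_trans (rank_leq_col B)).
move=> /rowV0Pn[la /sub_kermxP laB la0]; by exists la.
Qed.

(* A family of [m] functions satisfies a linear relation between its values at
   [k > m] points; take [i] in the support of this relation. *)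
Lemma dependent_node (R : fieldType) (T : Type) m k (f : 'I_m -> T -> R)
    (u : 'I_k -> T) : (m < k)%N ->
  exists i, forall h : T -> R,
    (exists c : 'I_m -> R, forall t, h t = \sum_j c j * f j t) ->
    (forall j, j != i -> h (u j) = 0) -> h (u i) = 0.
Proof.
move=> mk; have [la [la0 laB]] := left_kernel (\matrix_(i < k, j < m) f j (u i)) mk.
have /existsP[i lai] : [exists i, la 0 i != 0].
  rewrite -negb_forall; apply: contra_neqN la0 => /forallP la0.
  by apply/rowP => i; rewrite mxE; apply/eqP.
exists i => h [c hc] hu.
have : \sum_a la 0 a * h (u a) = 0.
  under eq_bigr do rewrite hc mulr_sumr.
  rewrite exchange_big big1// => j _.
  have /matrixP/(_ 0 j) := laB; rewrite !mxE => e.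
  transitivity (c j * \sum_a la 0 a * f j (u a)).
    by rewrite mulr_sumr; apply: eq_bigr => a _; rewrite mulrCA.
  rewrite (_ : \sum_a _ = 0) ?mulr0// -[RHS]e.
  by apply: eq_bigr => a _; rewrite mxE.
rewrite (bigD1 i)//= big1 ?addr0 => [/eqP|a ai]; last by rewrite hu ?mulr0.
by rewrite mulf_eq0 (negbTE lai) => /eqP.
Qed.

Lemma trig_span_Zn_numerator (R : realType) n (v1 v2 : seq R) : (0 < n)%N ->
  (size v1 + size v2).+1 = (2 * n)%N ->
  trig_span (@is_ice_freq R n) (Zn_numerator n v1 v2).
Proof. by move=> n0 /(Zn_numeratorP n0)[_ ? ?]; exact: trig_span_ice. Qed.

Lemma prod_sin_nseq (R : realType) m (t : R) :
  \prod_(w <- nseq m 0) sin (t - w) = sin t ^+ m.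
Proof.
elim: m => [|m IH]; first by rewrite big_nil.
by rewrite big_cons IH subr0 exprS.
Qed.

Lemma trig_span_fn (R : realType) n : (0 < n)%N -> trig_span (@is_ice_freq R n) (fn n).
Proof.
move=> n0; have sz : (size ([::] : seq R) + size (nseq (2 * n - 1) (0 : R))).+1 = (2 * n)%N.
  by rewrite size_nseq /=; lia.
apply: trig_span_ext (trig_span_Zn_numerator n0 sz) => t.
by rewrite /fn /Zn_numerator /= prod_sin_nseq mulrC.
Qed.

(** The leading coefficient is the value of [Zn] at zero parameters, where every vertex weight is
    1. *)
Lemma fn_jet (R : realType) n : (0 < n)%N ->
  (forall m, (m < 2 * n - 1)%N -> derive1n m (@fn R n) 0 = 0) /\
  derive1n (2 * n - 1) (@fn R n) 0 = (2 * n - 1)`!%:R * #|ASM n|%:R.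
Proof.
move=> n0; have sz : (size ([::] : seq R) + size (nseq (2 * n - 1) (0 : R))).+1 = (2 * n)%N.
  by rewrite size_nseq /=; lia.
have [TZ _ _] := Zn_numeratorP n0 sz.
have [h1 h2] := trig_poly_sin_order (2 * n - 1) TZ.
split; first exact: h1.
rewrite h2 /= -(Zn_zeros R n0); congr (_ * Zn n _).
by rewrite -[in RHS](prednK (_ : 0 < 2 * n)%N) ?muln_gt0// -subn1.
Qed.

(* The value at [k = 0] makes the formula for 0 parameters read [Zn n 0 = A_n]. *)
Fixpoint zeta_inv (R : realType) (n k : nat) : R :=
  if k is k'.+1 then zeta_inv R n k' * (#|ASM n|%:R * ((2 * n - 1) ^_ k')%:R)
  else #|ASM n|%:R^-1.

Lemma derive1n_sum (R : realType) (K : R -> Prop) (f : R -> R) m k (c : 'I_k -> R) :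
  trig_span K f ->
  derive1n m (fun t => \sum_(j < k) c j * derive1n j f t) =
  fun t => \sum_(j < k) c j * derive1n (m + j) f t.
Proof.
move=> Sf; elim: k c => [|k IH] c.
  have -> : (fun t => \sum_(j < 0) c j * derive1n j f t) = fun=> 0.
    by apply/funext => t; rewrite big_ord0.
  have D0 : derive1 (fun=> 0 : R) = fun=> 0.
    by apply/funext => t; rewrite derive1E; apply: derive_val; exact: is_derive_cst.
  rewrite (_ : derive1n m (fun=> 0) = fun=> 0); first by apply/funext => t; rewrite big_ord0.
  by elim: m => [//|m IH]; rewrite /derive1n iterS -/(derive1n m _) IH.
have -> : (fun t => \sum_(j < k.+1) c j * derive1n j f t) = fun t =>
    c ord_max * derive1n k f t + \sum_(j < k) c (widen_ord (leqnSn k) j) * derive1n j f t.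
  by apply/funext => t; rewrite big_ord_recr addrC.
rewrite (derive1n_comb (K := K)).
- rewrite IH; apply/funext => t; rewrite big_ord_recr addrC.
  by rewrite /derive1n -iterD.
- exact: trig_span_derive1n.
- apply: trig_span_sum => j.
  exact/trig_span_scale/trig_span_derive1n.
Qed.

(* [H t] is the difference of the two sides of the formula for [k.+1] parameters
   with [u i] replaced by [t]: the hypothesis for [k] parameters says that its
   coefficient of order [2 n - k.+1] at 0 vanishes. *)
Lemma fn_det_step (R : realType) n k (u : 'I_k.+1 -> R) (v1 v2 : seq R) (i : 'I_k.+1) D :
  (0 < n)%N -> (k < 2 * n)%N ->
  perm_eq (v1 ++ v2) ([seq u (lift i l) | l <- enum 'I_k] ++ nseq (2 * n - k.+1) 0) ->
  zeta_inv R n k * (Zn n (v1 ++ 0 :: v2) *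
    (\prod_l sin (u (lift i l)) ^+ (2 * n - k) * sin_vdm (u \o lift i))) =
    \det (\matrix_(a < k, j < k) derive1n j (fn n) (u (lift i a))) ->
  D = \matrix_(a < k.+1, j < k.+1) derive1n j (fn n) (u a) ->
  let H t := zeta_inv R n k.+1 * (\prod_l sin (u (lift i l)) ^+ (2 * n - k.+1)) * (-1) ^+ i *
      sin_vdm (u \o lift i) * Zn_numerator n v1 v2 t
    - \sum_j cofactor D i j * derive1n j (fn n) t in
  [/\ exists c : 'I_k -> R, forall t, H t = \sum_j c j * derive1n j (fn n) t,
      forall j, j != i -> H (u j) = 0 &
      H (u i) = zeta_inv R n k.+1 * (Zn n (v1 ++ u i :: v2) *
        (\prod_a sin (u a) ^+ (2 * n - k.+1) * sin_vdm u)) - \det D].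
Proof.
move=> n0 kn pv IH DE H.
have sv : (size v1 + size v2).+1 = (2 * n)%N.
  by rewrite -size_cat (perm_size pv) size_cat size_map size_enum_ord size_nseq; lia.
have prodE t : \prod_(w <- v1 ++ v2) sin (t - w) =
    (\prod_l sin (t - u (lift i l))) * sin t ^+ (2 * n - k.+1).
  by rewrite (perm_big _ pv) big_cat /= prod_sin_nseq big_map big_enum.
have Sf := trig_span_fn R n0; have [f0 f1] := fn_jet R n0.
have SN := trig_span_Zn_numerator n0 sv.
have [TZ _ _] := Zn_numeratorP n0 sv.
pose C := zeta_inv R n k.+1 * (\prod_l sin (u (lift i l)) ^+ (2 * n - k.+1)) * (-1) ^+ i *
      sin_vdm (u \o lift i).
have A0 : #|ASM n|%:R != 0 :> R by rewrite pnatr_eq0 -lt0n card_ASM_gt0.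
have HE : H = fun t => -1 * (\sum_j cofactor D i j * derive1n j (fn n) t) +
    C * Zn_numerator n v1 v2 t.
  by apply/funext => t; rewrite mulN1r addrC.
have SS : trig_span (@is_ice_freq R n) (fun t => \sum_j cofactor D i j * derive1n j (fn n) t).
  by apply: trig_span_sum => j; exact/trig_span_scale/trig_span_derive1n.
split.
- apply: (ice_derivative_basis Sf f0) => //.
  + by rewrite f1 mulf_neq0// pnatr_eq0 -lt0n fact_gt0.
  + exact: ltnW.
  + by rewrite HE; apply: trig_span_comb => //; exact: trig_span_scale.
  move=> m mk.
  pose h t := C * (Zn n (v1 ++ t :: v2) * \prod_l sin (t - u (lift i l))).
  have Th : trig_poly (n - 1 + size (enum 'I_k)) h.
    apply: trig_poly_scale; apply: trig_poly_mul => //.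
    apply: trig_poly_ext (trig_poly_prod (enum 'I_k)
      (F := fun l t => sin (t - u (lift i l))) _) => [t|l].
      by rewrite big_enum.
    exact: trig_poly_sinB.
  have NE : (fun t => C * Zn_numerator n v1 v2 t) =
      fun t => sin t ^+ (2 * n - k.+1) * h t.
    by apply/funext => t; rewrite /Zn_numerator /h prodE; ring.
  have [h0 h1] := trig_poly_sin_order (2 * n - k.+1) Th.
  rewrite HE (derive1n_comb _ _ SS (trig_span_scale C SN)) NE (derive1n_sum _ _ Sf).
  have [mk'|mk'] := ltnP m (2 * n - k.+1).
    rewrite h0// addr0 big1 ?mulr0// => j _.
    by rewrite f0 ?mulr0//; have := ltn_ord j; lia.
  (* At this order only the last term of the cofactor sum survives. Up to sign its coefficient is
     the determinant without [u i], which [IH] evaluates with 0 in the place of [u i]. *)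
  have -> : m = (2 * n - k.+1)%N by lia.
  rewrite h1 big_ord_recr /= big1 ?add0r; last first.
    by move=> j _; rewrite f0 ?mulr0//; have := ltn_ord j; lia.
  have -> : (2 * n - k.+1 + k = 2 * n - 1)%N by lia.
  rewrite f1 /cofactor /=.
  have -> : row' i (col' ord_max D) = \matrix_(a < k, j < k) derive1n j (fn n) (u (lift i a)).
    by apply/matrixP => a j; rewrite DE !mxE lift_max.
  rewrite -IH /h /C.
  have -> : \prod_l sin (0 - u (lift i l)) = (-1) ^+ k * \prod_l sin (u (lift i l)).
    rewrite (eq_bigr (fun l => -1 * sin (u (lift i l)))); last first.
      by move=> l _; rewrite sub0r sinN mulN1r.
    by rewrite big_split /= prodr_const card_ord.
  have -> : \prod_l sin (u (lift i l)) ^+ (2 * n - k) =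
      \prod_l sin (u (lift i l)) ^+ (2 * n - k.+1) * \prod_l sin (u (lift i l)).
    rewrite -big_split /=; apply: eq_bigr => l _.
    by rewrite -exprSr; congr (_ ^+ _); lia.
  have -> : (2 * n - 1)`!%:R = ((2 * n - 1) ^_ k)%:R * (2 * n - k.+1)`!%:R :> R.
    rewrite -natrM -(@ffact_fact (2 * n - 1) k); last by lia.
    by congr (_ * _`!)%:R; lia.
  rewrite /= exprD; ring.
(* The numerator contains [sin (u j - u j)], and the cofactor sum is an off-diagonal entry of [D]
   times its adjugate. *)
- move=> j ji; rewrite /H.
  have -> : Zn_numerator n v1 v2 (u j) = 0.
    case: (unliftP i j) ji => [l ->|->]; last by rewrite eqxx.
    by rewrite /Zn_numerator prodE (bigD1 l)//= subrr sin0 !mul0r mulr0.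
  rewrite mulr0 sub0r; have /matrixP/(_ j i) := mul_mx_adj D.
  rewrite !mxE (negbTE ji) mulr0n => e; apply/eqP; rewrite oppr_eq0; apply/eqP.
  rewrite -[RHS]e.
  by apply: eq_bigr => a _; rewrite {2}DE !mxE mulrC.
- rewrite /H (expand_det_row D i); congr (_ - _); last first.
    by apply: eq_bigr => j _; rewrite mulrC; congr (_ * _); rewrite DE mxE.
  rewrite /Zn_numerator prodE (sin_vdm_lift u i).
  rewrite [\prod_(a < k.+1) sin (u a) ^+ (2 * n - k.+1)](bigD1_ord i)//=.
  ring.
Qed.

(** Without denominators the induction passes freely through coinciding parameters and zero
    sines. *)
Lemma Zn_determinant (R : realType) n k (u : 'I_k -> R) (v : seq R) :
  (0 < n)%N -> (k <= 2 * n)%N ->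
  perm_eq v ([seq u i | i <- enum 'I_k] ++ nseq (2 * n - k) 0) ->
  zeta_inv R n k * (Zn n v * (\prod_i sin (u i) ^+ (2 * n - k) * sin_vdm u)) =
  \det (\matrix_(i < k, j < k) derive1n j (fn n) (u i)).
Proof.
move=> n0; elim: k u v => [|k IH] u v kn pv.
  have -> : v = nseq (2 * n) 0.
    move: pv; rewrite enum_ord0 /= subn0 => pv.
    rewrite -(size_nseq (2 * n) (0 : R)) -(perm_size pv); apply/all_pred1P.
    by rewrite (perm_all _ pv) all_pred1_nseq /= ?eqxx ?orbT.
  rewrite (Zn_zeros R n0) /sin_vdm !big_ord0 !mulr1 det_mx00 /= mulVf//.
  by rewrite pnatr_eq0 -lt0n card_ASM_gt0.
(* On [k + 1] nodes the first [k] derivatives are dependent; for their combinations, vanishing at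
   the other nodes forces vanishing at [u i]. *)
have [i Hi] := @dependent_node R R k k.+1 (fun j => derive1n j (fn n)) u (ltnSn k).
have pi : perm_eq v (u i :: [seq u (lift i l) | l <- enum 'I_k] ++ nseq (2 * n - k.+1) 0).
  apply: (perm_trans pv); rewrite -cat_cons perm_cat2r.
  by have := perm_map u (perm_enum_lift i); rewrite /= -map_comp.
have : u i \in v by rewrite (perm_mem pi) mem_head.
(* The slot of [u i] in [v] is kept; filling it with 0 gives an arrangement of [k] parameters,
   covered by [IH] as it allows any order. *)
move=> uv; case/splitPr: uv pi {pv} => v1 v2 pi.
have pv : perm_eq (v1 ++ v2) ([seq u (lift i l) | l <- enum 'I_k] ++ nseq (2 * n - k.+1) 0).
  rewrite -(perm_cons (u i)); apply: perm_trans pi.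
  by rewrite -[u i :: v2]cat1s -cat1s perm_catCA.
have IHk : zeta_inv R n k * (Zn n (v1 ++ 0 :: v2) *
    (\prod_l sin (u (lift i l)) ^+ (2 * n - k) * sin_vdm (u \o lift i))) =
    \det (\matrix_(a < k, j < k) derive1n j (fn n) (u (lift i a))).
  apply: IH; first exact: ltnW.
  have -> : (2 * n - k = (2 * n - k.+1).+1)%N by lia.
  apply: (@perm_trans _ (0 :: v1 ++ v2)).
    by rewrite -[0 :: v2]cat1s -[0 :: v1 ++ v2]cat1s perm_catCA.
  rewrite perm_sym -[nseq _.+1 _]/([:: 0] ++ nseq _ _) perm_catCA cat1s perm_cons.
  by rewrite perm_sym.
have [h1 h2 h3] := fn_det_step n0 kn pv IHk erefl.
by apply/eqP; rewrite -subr_eq0 -h3; apply/eqP; exact: Hi h1 h2.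
Qed.

Lemma zeta_invE (R : realType) n k : (0 < k)%N -> (k <= 2 * n)%N ->
  zeta_inv R n k = (zeta R n k)^-1.
Proof.
have A0 : #|ASM n|%:R != 0 :> R by rewrite pnatr_eq0 -lt0n card_ASM_gt0.
rewrite /zeta invrK; case: k => // k _; elim: k => [|k IH] kn.
  by rewrite /= ffactn0 mulr1 mulVf// subnn expr0 big_geq// mulr1.
rewrite [LHS]/= -/(zeta_inv R n k.+1) IH; last exact: ltnW.
rewrite !subn1 /= exprSr -!mulrA; congr (_ * _); rewrite mulrCA; congr (_ * _).
have -> : ((2 * n).-1 ^_ k.+1)%:R = \prod_(1 <= j < k.+2) (2 * n - j)%:R :> R.
  rewrite -subn1; elim: (k.+1) => [|m IHm]; first by rewrite ffactn0 big_geq.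
  by rewrite ffactnSr natrM IHm [RHS]big_nat_recr//= -subnDA add1n.
(* The added factor [j = k.+1] has exponent 0; both products then run over the same range. *)
rewrite [X in X * _](_ : _ = \prod_(1 <= j < k.+2) (2 * n - j)%:R ^+ (k.+1 - j)); last first.
  by rewrite [RHS]big_nat_recr//= subnn expr0 mulr1.
rewrite -big_split /=; apply: eq_big_nat => j /andP[_ jk].
by rewrite -exprSr [(k.+2 - j)%N]subSn.
Qed.

Lemma hyperfactorial_prod n :
  hyperfactorial (2 * n - 1) = (\prod_(1 <= j < 2 * n) (2 * n - j) ^ (2 * n - j))%N.
Proof.
rewrite /hyperfactorial; case: n => [|n]; first by rewrite !big_geq.
have -> : (2 * n.+1 - 1).+1 = (2 * n.+1)%N by lia.
by rewrite big_nat_rev; apply: eq_big_nat => i _; rewrite add1n subSS.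
Qed.

(* The list v ranges over all orderings of the 2 n spectral parameters, so the
   value of Z_n is asserted for every distribution of them among x and y. *)
Theorem theorem2p3 (R : realType) (n : nat) (hn : (1 <= n)%N) :
  (forall k : nat, (1 <= k <= 2 * n)%N ->
   forall u : k.-tuple R,
     (forall i : 'I_k, sin (tnth u i) != 0) ->
     (forall i j : 'I_k, (i < j)%N -> sin (tnth u i - tnth u j) != 0) ->
   forall v : seq R, perm_eq v (u ++ nseq (2 * n - k) 0) ->
     Zn n v =
       zeta R n k * (\det (fn_derivative_mx n u) /
         ((\prod_(i < k) sin (tnth u i) ^+ (2 * n - k)) * sin_vandermonde u)))
  /\
  (forall u : (2 * n).-tuple R,
     (forall i : 'I_(2 * n), sin (tnth u i) != 0) ->
     (forall i j : 'I_(2 * n), (i < j)%N -> sin (tnth u i - tnth u j) != 0) ->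
   forall v : seq R, perm_eq v u ->
     Zn n v =
       (#|ASM n|%:R ^+ (2 * n - 1) * (hyperfactorial (2 * n - 1))%:R)^-1 *
       \det (fn_derivative_mx n u) *
       \prod_(i < 2 * n) \prod_(j < 2 * n | (i < j)%N)
         (sin (tnth u i - tnth u j))^-1).
Proof.
have general (k : nat) : (1 <= k <= 2 * n)%N -> forall u : k.-tuple R,
     (forall i : 'I_k, sin (tnth u i) != 0) ->
     (forall i j : 'I_k, (i < j)%N -> sin (tnth u i - tnth u j) != 0) ->
   forall v : seq R, perm_eq v (u ++ nseq (2 * n - k) 0) ->
     Zn n v =
       zeta R n k * (\det (fn_derivative_mx n u) /
         ((\prod_(i < k) sin (tnth u i) ^+ (2 * n - k)) * sin_vandermonde u)).
  move=> /andP[k0 kn] u su suu v pv.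
  have A0 : #|ASM n|%:R != 0 :> R by rewrite pnatr_eq0 -lt0n card_ASM_gt0.
  have := @Zn_determinant R n k (tnth u) v hn kn.
  rewrite map_tnth_enum zeta_invE// => /(_ pv) <-.
  have z0 : zeta R n k != 0.
    rewrite invr_eq0 mulf_neq0 ?expf_neq0// big_nat prodf_seq_neq0.
    apply/allP => j; rewrite mem_index_iota => /andP[_ jk].
    by apply/implyP => _; rewrite expf_neq0// pnatr_eq0; lia.
  have d0 : \prod_(i < k) sin (tnth u i) ^+ (2 * n - k) * sin_vandermonde u != 0.
    rewrite mulf_neq0//; first by apply/prodf_neq0 => i _; rewrite expf_neq0.
    by apply/prodf_neq0 => i _; apply/prodf_neq0 => j; exact: suu.
  by rewrite -[sin_vdm _]/(sin_vandermonde u) -mulrA mulfK// mulVKf.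
split=> // u su suu v pv; have n2 : (1 <= 2 * n <= 2 * n)%N by lia.
rewrite (general _ n2 u su suu v) ?subnn ?cats0// /zeta hyperfactorial_prod.
rewrite natr_prod (eq_bigr _ (fun i _ => natrX _ _ _)) -mulrA; congr (_ * (_ * _)).
(* For [k = 2 n] the powers of [sin (tnth u i)] have exponent 0. *)
rewrite [X in (X * _)^-1]big1 ?mul1r//.
rewrite /sin_vandermonde -prodfV; apply: eq_bigr => i _.
by rewrite -prodfV.
Qed.
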